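(* Let $(\Omega,\mathcal F,\mathbb P)$ be a non-atomic probability space, $d\ge1$, $p\ge1$, $X\in L^\infty(\Omega,\mathbb R^d)$ with law $m_0$, and let $B\subset\mathbb R^d$ be a closed ball centered at $0$ with $m_0(pB)=1$. Let $\gamma\in\mathcal M_B(m_0)$ and let $w=(w_1,\dots,w_p)$ be a family of strictly convex functions in $C^1(B)$. Then: 1. if $\gamma$ is $w$-strictly comonotone, then $\gamma$ is efficient; 2. if $\gamma$ is efficient, then $\gamma$ is $w'$-comonotone for every family $w'=(w'_1,\dots,w'_p)$ of strictly convex functions in $C^1(B)$; 3. the closure, for the weak-star topology, of the set of efficient allocations in $\mathcal M_B(m_0)$ coincides with the set of $w$-comonotone allocations (which is therefore independent of $w$).
   Context: $\mathcal M(m_0)$ is the set of compactly supported probability measures $\gamma$ on $(\mathbb R^d)^p$ such that the image of $\gamma$ under $(x_1,\dots,x_p)\mapsto\sum_{i=1}^p x_i$ is $m_0$, and $\mathcal M_B(m_0)=\{\gamma\in\mathcal M(m_0):\gamma(B^p)=1\}$; its elements are called allocations. $pB=\{px:x\in B\}$. The weak-star topology is that of convergence against functions in $C(B^p)$. $\mathcal C$ is the cone of convex continuous real-valued functions on $B$. Dominance: for $\gamma,\pi\in\mathcal M_B(m_0)$, $\gamma$ dominates $\pi$ if $\int_{B^p}\sum_{i=1}^p\varphi_i(x_i)\,d\gamma(x)\le\int_{B^p}\sum_{i=1}^p\varphi_i(x_i)\,d\pi(x)$ for all $(\varphi_1,\dots,\varphi_p)\in\mathcal C^p$; $\gamma$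 strictly dominates $\pi$ if, in addition, the inequality is strict whenever all the $\varphi_i\in\mathcal C$ are strictly convex. $\gamma\in\mathcal M_B(m_0)$ is efficient if no element of $\mathcal M_B(m_0)$ strictly dominates it. For a family $\psi=(\psi_1,\dots,\psi_p)$ of strictly convex continuous functions on $B$ and $x\in pB$, $T_\psi(x)=(T^1_\psi(x),\dots,T^p_\psi(x))$ denotes the unique minimizer of $\sum_{i=1}^p\psi_i(y_i)$ over $(y_1,\dots,y_p)\in B^p$ with $\sum_{i=1}^p y_i=x$. $\gamma_\psi\in\mathcal M_B(m_0)$ is the image of $m_0$ under $T_\psi$, i.e. $\int_{B^p}f\,d\gamma_\psi=\int_{pB}f(T_\psi(x))\,dm_0(x)$ for all $f\in C(B^p)$. $\gamma\in\mathcal M_B(m_0)$ is $w$-strictly comonotone if $\gamma=\gamma_\psi$ for some family $\psi=(\psi_1,\dots,\psi_p)$ of convex continuous functions on $B$ with $\psi_i-w_i\in\mathcal C$ for every $i$ (each such $\psi_i$ is then strictly convex). $\gamma\in\mathcal M_B(m_0)$ is $w$-comonotone if there is a sequence of $w$-strictly comonotone elements of $\mathcal M_B(m_0)$ converging weakly star to $\gamma$. *)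

(* Defs.v *)
(* A point of (R^d)^p is a p x d matrix, its i-th component
   x_i being the i-th row; a function on a set D is a total function of which
   only the values on D are used. In the definitions, m is the law m_0. *)
From HB Require Import structures.
From mathcomp Require Import all_boot all_order all_algebra.
From mathcomp Require Import all_classical all_reals all_analysis.

Set Implicit Arguments.
Unset Strict Implicit.
Unset Printing Implicit Defensive.

Import Order.TTheory GRing.Theory Num.Theory.
Import numFieldNormedType.Exports.

Local Open Scope classical_set_scope.
Local Open Scope ring_scope.

Definition mx_open (R : realType) (m n : nat) : set (set 'M[R]_(m, n)) := open.

(* Borel sigma-algebra of the (product) topology on matrices. *)
HB.instance Definition _ (R : realType) (m n : nat) :=
  @isMeasurable.Build (@mx_open R m n).-sigma%mdisp 'M[R]_(m, n)
    <<s @mx_open R m n >>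
    (@sigma_algebra0 _ setT _) (@sigma_algebraC _ _)
    (@sigma_algebra_bigcup _ setT _).

Definition nonatomic dsp (T : measurableType dsp) (R : realType)
    (P : probability T R) : Prop :=
  forall A, measurable A -> (0 < P A)%E ->
    exists A', [/\ measurable A', A' `<=` A, (0 < P A')%E & (P A' < P A)%E].

(* The norm of the library on matrices is the sup norm. *)
Definition enorm (R : realType) (d : nat) (x : 'rV[R]_d) : R :=
  Num.sqrt (\sum_j x ord0 j ^+ 2).

Definition eclosed_ball (R : realType) (d : nat) (r : R) : set 'rV[R]_d :=
  [set x | enorm x <= r].

Definition dilate (R : realType) (d : nat) (a : R) (B : set 'rV[R]_d) :
  set 'rV[R]_d := [set a *: x | x in B].

Section Allocations.
Context {R : realType} {d p : nat}.
Implicit Types (B : set 'rV[R]_d) (m : probability 'rV[R]_d R).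
Implicit Types (gamma pi : probability 'M[R]_(p, d) R).
Implicit Types (phi psi w : 'I_p -> 'rV[R]_d -> R).

Definition msupport gamma : set 'M[R]_(p, d) :=
  [set x | forall U, open_nbhs x U -> (0 < gamma U)%E].

Definition aggregate (x : 'M[R]_(p, d)) : 'rV[R]_d := \sum_i row i x.

Definition set_pow B : set 'M[R]_(p, d) := [set x | forall i, B (row i x)].

Definition separable_sum phi (x : 'M[R]_(p, d)) : R := \sum_i phi i (row i x).

Definition allocation m gamma : Prop :=
  compact (msupport gamma) /\
  forall A, measurable A -> pushforward gamma aggregate A = m A.

Definition allocation_in B m gamma : Prop :=
  allocation m gamma /\ gamma (set_pow B) = 1%E.

Definition cvx_cont B (f : 'rV[R]_d -> R) : Prop :=
  {within B, continuous f} /\ convex_function B (f : _ -> R^o).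

Definition strictly_convex B (f : 'rV[R]_d -> R) : Prop :=
  forall (t : R) (x y : 'rV[R]_d), B x -> B y -> x != y -> 0 < t < 1 ->
    f (t *: x + (1 - t) *: y) < t * f x + (1 - t) * f y.

(* C^1 up to the boundary: the directional derivatives, defined in the
   interior, extend continuously to the closed set B. *)
Definition C1_on B (f : 'rV[R]_d -> R) : Prop :=
  [/\ {within B, continuous f},
      forall x, interior B x -> differentiable (f : _ -> R^o) x
    & forall v : 'rV[R]_d, exists g : 'rV[R]_d -> R,
        {within B, continuous g} /\
        forall x, interior B x -> 'D_v (f : _ -> R^o) x = g x].

Definition dominates B gamma pi : Prop :=
  forall phi, (forall i, cvx_cont B (phi i)) ->
    \int[gamma]_(x in set_pow B) separable_sum phi x <=
    \int[pi]_(x in set_pow B) separable_sum phi x.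

Definition strictly_dominates B gamma pi : Prop :=
  dominates B gamma pi /\
  forall phi, (forall i, cvx_cont B (phi i)) ->
    (forall i, strictly_convex B (phi i)) ->
    \int[gamma]_(x in set_pow B) separable_sum phi x <
    \int[pi]_(x in set_pow B) separable_sum phi x.

Definition efficient B m gamma : Prop :=
  allocation_in B m gamma /\
  ~ exists pi, allocation_in B m pi /\ strictly_dominates B pi gamma.

Definition splits B (x : 'rV[R]_d) : set 'M[R]_(p, d) :=
  [set y | set_pow B y /\ aggregate y = x].

Definition minimizers B psi (x : 'rV[R]_d) : set 'M[R]_(p, d) :=
  [set y | splits B x y /\
     forall z, splits B x z -> separable_sum psi y <= separable_sum psi z].

(* [get] selects an element of a nonempty set: here the minimizer, which is
   unique when the psi i are continuous and strictly convex and x is in pB. *)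
Definition T_psi B psi (x : 'rV[R]_d) : 'M[R]_(p, d) := get (minimizers B psi x).

Definition is_gamma_psi B m psi gamma : Prop :=
  forall f : 'M[R]_(p, d) -> R, {within set_pow B, continuous f} ->
    \int[gamma]_(x in set_pow B) f x =
    \int[m]_(x in dilate p%:R B) f (T_psi B psi x).

Definition strictly_comonotone B m w gamma : Prop :=
  allocation_in B m gamma /\
  exists psi, [/\ forall i, cvx_cont B (psi i),
                  forall i, cvx_cont B (psi i \- w i)
                & is_gamma_psi B m psi gamma].

Definition cont_fun B : Type :=
  {f : 'M[R]_(p, d) -> R | {within set_pow B, continuous f}}.

HB.instance Definition _ B := gen_eqMixin (cont_fun B).
HB.instance Definition _ B := gen_choiceMixin (cont_fun B).

Definition cont_fun_int B (gamma : probability 'M[R]_(p, d) R) :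
    {ptws cont_fun B -> R} :=
  fun f => \int[gamma]_(x in set_pow B) sval f x.

(* Coarsest topology making gamma |-> \int f dgamma continuous for every f in
   C(B^p). *)
Definition weak_star B : topologicalType := initial_topology (@cont_fun_int B).

Definition comonotone B m w gamma : Prop :=
  allocation_in B m gamma /\
  exists g : nat -> probability 'M[R]_(p, d) R,
    (forall n, strictly_comonotone B m w (g n)) /\
    ((g : nat -> weak_star B) @ \oo --> (gamma : weak_star B)).

(* Closure in the space allocation_in B m with the topology induced by
   weak_star B. *)
Definition weak_star_closure B m (E : set (probability 'M[R]_(p, d) R)) :
    set (probability 'M[R]_(p, d) R) :=
  allocation_in B m `&` closure (E : set (weak_star B)).

End Allocations.

(* Main.v *)
(* Everything is played on the maps [S] of [B^p] into itself that preserve the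
   aggregate ("admissible" maps): the law of [S] under [gamma] is again an
   allocation, and minimizing [\int psi dpi] over all allocations [pi] is the same
   as minimizing it over those laws, the minimum being reached at [T_psi].

   If [gamma = gamma_psi] and [pi] strictly dominates it, integrating
   [psi (T_psi x) <= psi y] for [x] the aggregate of [y] against [pi] contradicts
   [\int psi dpi < \int psi dgamma].

   If [gamma] is efficient, consider the zero-sum game with payoff
   [\int (w + phi)(S) - \int (w + phi)], where [S] is minimized over admissible
   maps and [phi] maximized over families of convex functions.  If its lower value
   were less than [-e], a minimax argument would give one [S] with payoff at most
   [-e] against all [phi]; scaling [phi], the law of [S] dominates [gamma], and
   that of [(S + id) / 2] does so strictly.  The minimax map is an L^2 limit of
   near-minimizers of the energy in a decreasing sequence of convex sets.  Hence
   there are [phi_n] with payoff at least [-1/(n+1)] against [T_(w + phi_n)]; the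
   payoff controls the Jensen gap of [w] between [id] and [T_(w + phi_n)], so
   that [gamma_(w + phi_n)] tends to [gamma]. *)
Require Import Defs.
From HB Require Import structures.
From mathcomp Require Import all_boot all_order all_algebra.
From mathcomp Require Import all_classical all_reals all_analysis.
From mathcomp Require Import measurable_realfun.
From mathcomp Require Import ring lra.

Set Implicit Arguments.
Unset Strict Implicit.
Unset Printing Implicit Defensive.

Import Order.TTheory GRing.Theory Num.Theory.
Import numFieldNormedType.Exports.

Local Open Scope classical_set_scope.
Local Open Scope ring_scope.

(** * Borel measurability of matrix-valued maps *)

Lemma closed_within_preimage (S U : topologicalType) (A : set S) (f : S -> U)
    (C : set U) :
  closed A -> {within A, continuous f} -> closed C -> closed (A `&` f @^-1` C).
Proof.
move=> cA /continuous_closedP cf cC.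
have /closed_subspaceP[V cV VA] := cf C cC.
by rewrite setIC -VA; exact: closedI.
Qed.

Section MatrixBorel.
Context {R : realType} {m n : nat}.

Lemma open_mx_measurable (U : set 'M[R]_(m, n)) : open U -> measurable U.
Proof. by move=> oU; exact: sub_sigma_algebra. Qed.

Lemma closed_mx_measurable (C : set 'M[R]_(m, n)) : closed C -> measurable C.
Proof.
by move=> /closed_openC/open_mx_measurable/measurableC; rewrite setCK.
Qed.

Lemma compact_mx_measurable (C : set 'M[R]_(m, n)) : compact C -> measurable C.
Proof.
by move=> cC; apply: closed_mx_measurable; apply: compact_closed.
Qed.

Lemma within_continuous_measurable_fun (D : set 'M[R]_(m, n))
    (f : 'M[R]_(m, n) -> R) :
  measurable D -> {within D, continuous f} -> measurable_fun D f.
Proof.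
move=> mD /continuousP cf.
apply: (measurability _ (RGenOpens.measurableE R)).
move=> _ [_ [a [b ->] <-]].
have /open_subspaceP[V oV VD] := cf _ (@interval_open R (BRight a) (BLeft b) isT isT).
by rewrite setIC -VD; apply: measurableI => //; exact: open_mx_measurable.
Qed.

Lemma continuous_mx_measurable_fun (m' n' : nat)
    (f : 'M[R]_(m, n) -> 'M[R]_(m', n')) :
  continuous f -> measurable_fun setT f.
Proof.
move=> /continuousP cf; apply: (@measurability _ _ _ _ _ _ (@mx_open R m' n')) => //.
by move=> _ [U oU <-]; rewrite setTI; apply: open_mx_measurable; exact: cf.
Qed.

Lemma measurable_coord (i : 'I_m) (j : 'I_n) :
  measurable_fun setT (fun M : 'M[R]_(m, n) => M i j).
Proof.
apply: within_continuous_measurable_fun => //.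
by apply: continuous_subspaceT => x; exact: coord_continuous.
Qed.

(** An open set of matrices is a countable union of sup-norm balls [box] with rational centres and
    radii [1/(k+1)], and such a ball constrains the entries separately; so measurability of the
    entries suffices. *)
Lemma measurable_fun_mxP d (S : measurableType d) (D : set S)
    (f : S -> 'M[R]_(m, n)) : measurable D ->
  measurable_fun D f <->
  forall i j, measurable_fun D (fun x => f x i j).
Proof.
move=> mD; split=> [mf i j|mf].
  exact: (measurable_comp measurableT _ (measurable_coord i j) mf).
apply: (@measurability _ _ _ _ _ _ (@mx_open R m n)) => //.
move=> _ [U oU <-].
pose box (c : 'M[rat]_(m, n) * nat) :=
  ball (map_mx (@ratr R) c.1) (c.2.+1%:R^-1 : R).
have UE : U = \bigcup_(c in [set c | box c `<=` U]) box c.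
  apply/seteqP; split => [x Ux|x [c cU /cU//]].
  have /nbhs_ballP[e /= e0 eU] : nbhs x U by exact: open_nbhs_nbhs.
  (* As [2 * delta < e], a ball of radius [delta] whose centre is within [delta] of [x] lies in the
     [e]-ball of [x]. *)
  have [k ke] : exists k : nat, (k.+1%:R^-1 : R) < e / 2.
    have e2 : 0 < e / 2 by lra.
    have := near_infty_natSinv_lt (PosNum e2) => -[k _ /(_ k (leqnn k))] /= ?.
    by exists k.
  pose delta := k.+1%:R^-1 : R.
  have {}ke : delta < e / 2 by [].
  have k0 : 0 < delta by rewrite invr_gt0.
  have /choice[q qP] : forall ij : 'I_m * 'I_n, exists q : rat,
      `|ratr q - x ij.1 ij.2| < delta.
    move=> [i j] /=.
    have [q] := @rat_in_itvoo R (x i j - delta) (x i j + delta)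
      ltac:(lra).
    rewrite in_itv /= => /andP[h1 h2].
    by exists q; rewrite ltr_norml; lra.
  exists (\matrix_(i, j) q (i, j), k).
    move=> y [_ yq]; apply: eU; split=> // i j.
    have := yq i j; rewrite !mxE -/delta => h.
    have {}h : `|ratr (q (i, j)) - y i j| < delta by [].
    have := qP (i, j) => /= h'.
    apply: (le_lt_trans (ler_distD (ratr (q (i, j))) _ _)).
    by rewrite (distrC (x i j)); lra.
  by split=> // i j; rewrite !mxE /ball /=; exact: qP.
rewrite UE preimage_bigcup setI_bigcupr bigcup_mkcond.
apply: countable_bigcupT_measurable => // -[q k].
case: ifPn => // _.
have -> : D `&` f @^-1` box (q, k) = D `&`
    \bigcap_(ij in [set: 'I_m * 'I_n])
      (D `&` [set x | ball (ratr (q ij.1 ij.2) : R) k.+1%:R^-1 (f x ij.1 ij.2)]).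
  apply/seteqP; split => x [Dx h]; split=> //.
    by move=> [i j] _; split=> //=; have := h.2 i j; rewrite mxE.
  split; first by rewrite /= invr_gt0.
  by move=> i j; have := (h (i, j) I).2; rewrite mxE.
apply: measurableI => //; apply: fin_bigcap_measurable => // -[i j] _ /=.
apply: (mf i j mD [set y | ball (ratr (q i j) : R) k.+1%:R^-1 y]).
by apply: open_measurable; apply: ball_open; rewrite invr_gt0.
Qed.

End MatrixBorel.

(** * Convexity and compactness of balls and their powers *)

Lemma within_continuous_comp_sub (S U V : topologicalType) (D : set S)
    (A : set U) (g : S -> U) (f : U -> V) :
  (forall x, D x -> A (g x)) -> {within D, continuous g} ->
  {within A, continuous f} -> {within D, continuous (f \o g)}.
Proof.
move=> DA /subspace_continuousP cg /subspace_continuousP cf.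
apply/subspace_continuousP => x Dx W /= nW.
have /= := cg _ Dx _ (cf _ (DA _ Dx) _ nW); rewrite /within /=.
by apply: (@filterS _ (nbhs x)) => y /= h Dy; exact: h Dy (DA _ Dy).
Qed.

Lemma cvg_sumr (R : realType) (S I : Type) (F : set_system S) {FF : Filter F}
    (r : seq I) (f : I -> S -> R) (l : I -> R) :
  (forall i, f i x @[x --> F] --> l i) ->
  \sum_(i <- r) f i x @[x --> F] --> \sum_(i <- r) l i.
Proof. by move=> fl; apply: cvg_big => //; exact: add_continuous. Qed.

Lemma cvg_mx (S : Type) (R : realType) (m n : nat) (F : set_system S)
    {FF : Filter F} (f : S -> 'M[R]_(m, n)) (M : 'M[R]_(m, n)) :
  (forall i j, f x i j @[x --> F] --> M i j) -> f x @[x --> F] --> M.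
Proof.
move=> fM A [P MP PA].
have : \forall x \near F, forall ij : 'I_m * 'I_n, P ij.1 ij.2 (f x ij.1 ij.2).
  by apply: filter_forall => -[i j]; apply: fM; exact: MP.
by apply: filterS => x fx; apply: PA => i j; exact: (fx (i, j)).
Qed.

Definition convex_subset (R : realType) (V : lmodType R) (A : set V) :=
  forall (t : R) x y, A x -> A y -> 0 <= t <= 1 -> A (t *: x + (1 - t) *: y).

Definition convex_on (R : realType) (V : lmodType R) (A : set V) (f : V -> R) :=
  forall (t : R) x y, A x -> A y -> 0 <= t <= 1 ->
    f (t *: x + (1 - t) *: y) <= t * f x + (1 - t) * f y.

Lemma convex_functionE (R : realType) (V : lmodType R) (A : set V) (f : V -> R) :
  convex_function A (f : _ -> R^o) <-> convex_on A f.
Proof.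
split=> [cf t x y Ax Ay /andP[t0 t1]|cf t x y /set_mem Ax /set_mem Ay].
  by have := cf (Itv01 t0 t1) x y (mem_set Ax) (mem_set Ay).
by apply: cf => //; apply/andP; split.
Qed.

Section Ball.
Context {R : realType} {d : nat}.
Variables (r : R).
Hypothesis r0 : 0 < r.

Lemma eclosed_ballE :
  @eclosed_ball R d r = [set x | \sum_j x ord0 j ^+ 2 <= r ^+ 2].
Proof.
have s0 (x : 'rV[R]_d) : 0 <= \sum_j x ord0 j ^+ 2.
  by apply: sumr_ge0 => j _; exact: sqr_ge0.
apply/seteqP; split => x; rewrite /eclosed_ball /enorm /= => h.
  by rewrite -(sqr_sqrtr (s0 x)) ler_pXn2r // ?nnegrE ?sqrtr_ge0 // ltW.
rewrite -(ger0_norm (ltW r0)) -sqrtr_sqr; exact: ler_wsqrtr.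
Qed.

Lemma compact_eclosed_ball : compact (@eclosed_ball R d r).
Proof.
apply: bounded_closed_compact.
  rewrite /bounded_set /bounded_near /=; exists r; split; first exact: num_real.
  move=> M rM x; rewrite eclosed_ballE /= => xr.
  apply: (le_trans _ (ltW rM)); rewrite -[`|x|]/(mx_norm x) mx_normrE.
  apply: bigmax_le => [|[i j] _]; first exact: ltW.
  rewrite /= (ord1 i) -(@ler_pXn2r _ 2) // ?nnegrE ?(ltW r0) //.
  rewrite real_normK ?num_real //; apply: le_trans xr.
  by rewrite (bigD1 j) //= lerDl; apply: sumr_ge0 => k _; exact: sqr_ge0.
rewrite eclosed_ballE.
rewrite -[X in closed X]/((fun x : 'rV[R]_d => \sum_j x ord0 j ^+ 2) @^-1`
  [set y | y <= r ^+ 2]).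
apply: preimage_closed; last exact: closed_le.
move=> x _; apply: (@cvg_sumr _ _ _ (nbhs x)) => j; rewrite expr2.
by under eq_fun do rewrite expr2; apply: cvgM; exact: coord_continuous.
Qed.

Lemma convex_eclosed_ball : convex_subset (@eclosed_ball R d r).
Proof.
move=> t x y; rewrite eclosed_ballE /= => xr yr /andP[t0 t1].
apply: (@le_trans _ _ (\sum_j (t * x ord0 j ^+ 2 + (1 - t) * y ord0 j ^+ 2))).
  apply: ler_sum => j _; rewrite !mxE -subr_ge0.
  rewrite (_ : _ - _ = t * (1 - t) * (x ord0 j - y ord0 j) ^+ 2); last by ring.
  by rewrite mulr_ge0 ?sqr_ge0 // mulr_ge0 // subr_ge0.
rewrite big_split /= -!mulr_sumr.
by apply: (le_trans (lerD (ler_wpM2l t0 xr) (ler_wpM2l _ yr))); lra.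
Qed.

End Ball.

Section Geometry.
Context {R : realType} {d p : nat}.
Variables (B : set 'rV[R]_d).
Hypotheses (B_compact : compact B) (B_convex : convex_subset B).
Local Notation K := (@set_pow R d p B).

Lemma continuous_row (i : 'I_p) :
  continuous (row i : 'M[R]_(p, d) -> 'rV[R]_d).
Proof.
by move=> x; apply: (@cvg_mx _ _ _ _ (nbhs x)) => k j; rewrite mxE;
  under eq_fun do rewrite mxE;
  exact: coord_continuous.
Qed.

Lemma continuous_aggregate : continuous (@aggregate R d p).
Proof.
move=> x; apply: (@cvg_mx _ _ _ _ (nbhs x)) => i j; rewrite summxE.
under eq_fun do rewrite summxE; apply: (@cvg_sumr _ _ _ (nbhs x)) => k.
by rewrite mxE; under eq_fun do rewrite mxE; exact: coord_continuous.
Qed.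

(** [K] is the image, under a continuous reshaping, of a set of row vectors of row vectors that is a
    product of copies of [B]. *)
Lemma compact_set_pow : compact K.
Proof.
pose f (v : 'rV['rV[R]_d]_p) : 'M[R]_(p, d) := \matrix_(i, j) v ord0 i ord0 j.
have -> : K = f @` [set v : 'rV['rV[R]_d]_p | forall i, B (v ord0 i)].
  apply/seteqP; split => [x Kx|_ [v Bv <-] i].
    exists (\row_i row i x) => [i|]; first by rewrite mxE; exact: Kx.
    by apply/matrixP => i j; rewrite !mxE.
  suff -> : row i (f v) = v ord0 i by exact: Bv.
  by apply/rowP => j; rewrite !mxE.
apply: continuous_compact; last first.
  by apply: (@rV_compact _ _ (fun=> B)).
apply: continuous_subspaceT => v; apply: (@cvg_mx _ _ _ _ (nbhs v)) => i j; rewrite mxE.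
under eq_fun do rewrite mxE.
have c1 : {for v, continuous (fun w : 'rV['rV[R]_d]_p => w ord0 i)}.
  move=> A [P]; exists (fun a b => if (a == ord0) && (b == i) then A else setT).
    move=> a b; case: ifPn => [/andP[/eqP-> /eqP->]|_]; last exact: filterT.
    by exists P.
  by move=> w /(_ ord0 i); rewrite !eqxx.
exact: (continuous_comp c1 (@coord_continuous _ _ _ _ _ _)).
Qed.

Lemma closed_set_pow : closed K.
Proof. by apply: compact_closed => //; exact: compact_set_pow. Qed.

Lemma measurable_set_pow : measurable K.
Proof. exact: closed_mx_measurable closed_set_pow. Qed.

Lemma rowD_scale (s t : R) (x y : 'M[R]_(p, d)) i :
  row i (s *: x + t *: y) = s *: row i x + t *: row i y.
Proof. by rewrite !linearD !linearZ. Qed.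

Lemma aggregateD_scale (s t : R) (x y : 'M[R]_(p, d)) :
  aggregate (s *: x + t *: y) = s *: aggregate x + t *: aggregate y.
Proof.
by rewrite /aggregate !scaler_sumr -big_split; apply: eq_bigr => i _;
  exact: rowD_scale.
Qed.

Lemma convex_set_pow : convex_subset K.
Proof. by move=> t x y Kx Ky t01 i; rewrite rowD_scale; exact: B_convex. Qed.

Lemma convex_splits x : convex_subset (@splits R d p B x).
Proof.
move=> t y z [Ky yx] [Kz zx] t01; split; first exact: convex_set_pow.
by rewrite aggregateD_scale yx zx -scalerDl addrC subrK scale1r.
Qed.

(** Induction: the mean of [n + 2] points is the convex combination, with weight [(n+1)/(n+2)], of
    the mean of the first [n + 1] points and the last point. *)
Lemma convex_mean (n : nat) (x : 'I_n.+1 -> 'rV[R]_d) :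
  (forall i, B (x i)) -> B (n.+1%:R^-1 *: \sum_i x i).
Proof.
elim: n x => [|n IH] x Bx; first by rewrite big_ord1 invr1 scale1r.
have n0 : n.+1%:R != 0 :> R by rewrite pnatr_eq0.
have n1 : n.+2%:R != 0 :> R by rewrite pnatr_eq0.
have n2 : n.+2%:R = n.+1%:R + 1 :> R by rewrite natr1.
rewrite big_ord_recr /= scalerDr.
have := @B_convex (n.+1%:R / n.+2%:R)
  (n.+1%:R^-1 *: \sum_(i < n.+1) x (widen_ord (leqnSn n.+1) i)) (x ord_max)
  (IH _ (fun i => Bx _)) (Bx _).
rewrite scalerA mulrAC divff // mul1r.
rewrite (_ : 1 - n.+1%:R / n.+2%:R = n.+2%:R^-1); last first.
  by apply: (mulIf n1); rewrite mulrBl divfK // mulVf // mul1r n2 addrAC subrr add0r.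
apply; rewrite divr_ge0 //= ler_pdivrMr ?ltr0n // mul1r ler_nat.
by rewrite leqnSn.
Qed.

Lemma dilate_aggregate : (0 < p)%N -> dilate p%:R B = @aggregate R d p @` K.
Proof.
move=> p0; have p0' : p%:R != 0 :> R by rewrite pnatr_eq0 -lt0n.
apply/seteqP; split => [_ [x Bx <-]|_ [x Kx <-]].
  exists (\matrix_(i, j) x ord0 j) => [i|].
    suff -> : row i (\matrix_(i, j) x ord0 j) = x by [].
    by apply/rowP => j; rewrite !mxE.
  apply/rowP => j; rewrite summxE !mxE.
  under eq_bigr do rewrite !mxE.
  by rewrite sumr_const card_ord mulr_natl.
exists (p%:R^-1 *: aggregate x); last by rewrite scalerA divff // scale1r.
rewrite /aggregate; move: x Kx p0 {p0'}; case: p => // n x Kx _.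
exact: convex_mean.
Qed.

Lemma within_continuous_separable_sum (psi : 'I_p -> 'rV[R]_d -> R) :
  (forall i, {within B, continuous psi i}) ->
  {within K, continuous separable_sum psi}.
Proof.
move=> cpsi; apply/subspace_continuousP => x Kx.
apply: (@cvg_sumr _ _ _ (within K (nbhs x))) => i.
have /subspace_continuousP/(_ _ Kx) : {within K, continuous psi i \o row i}.
  apply: within_continuous_comp_sub (cpsi i) => [y /(_ i)//|].
  exact/continuous_subspaceT/continuous_row.
exact.
Qed.

End Geometry.

(** * Moduli of continuity and integrals of bounded functions *)

Section Modulus.
Context {R : realType} {m n : nat}.
Variables (K : set 'M[R]_(m, n)).
Hypothesis K_compact : compact K.

(** The pairs with [|f z - f y| >= e] form a compact set off the diagonal, on which [D] has a
    positive minimum; [C] is the maximum of [|f z - f y|] there divided by that minimum. The bound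
    is affine in [D], hence can be integrated; [D] will be a squared distance, a Jensen gap or a
    norm. *)
Lemma compact_modulus (f : 'M[R]_(m, n) -> R)
    (D : 'M[R]_(m, n) * 'M[R]_(m, n) -> R) (e : R) :
  {within K, continuous f} -> {within K `*` K, continuous D} ->
  (forall y z, K y -> K z -> 0 <= D (y, z)) ->
  (forall y z, K y -> K z -> y != z -> 0 < D (y, z)) -> 0 < e ->
  exists2 C, 0 <= C &
    forall y z, K y -> K z -> `|f z - f y| <= e + C * D (y, z).
Proof.
move=> cf cD D0 Dgt0 e0.
pose g (yz : 'M[R]_(m, n) * 'M[R]_(m, n)) := `|f yz.2 - f yz.1|.
have cKK : compact (K `*` K) by exact: compact_setX.
have clKK : closed (K `*` K) by apply: compact_closed.
have cg : {within K `*` K, continuous g}.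
  have c1 : {within K `*` K, continuous (f \o fst)}.
    apply: within_continuous_comp_sub cf => [[? ?] []//|].
    by apply: continuous_subspaceT => x; exact: cvg_fst.
  have c2 : {within K `*` K, continuous (f \o snd)}.
    apply: within_continuous_comp_sub cf => [[? ?] []//|].
    by apply: continuous_subspaceT => x; exact: cvg_snd.
  by move=> x; apply: cvg_norm; apply: cvgB; [exact: c2|exact: c1].
pose A := K `*` K `&` g @^-1` [set t | e <= t].
have cA : compact A.
  apply: (subclosed_compact _ cKK) => [|x []//].
  by apply: closed_within_preimage => //; exact: closed_ge.
have small y z : K y -> K z -> ~ A (y, z) -> `|f z - f y| <= e.
  move=> Ky Kz nA; rewrite leNgt; apply/negP => h; apply: nA.
  by split => //=; exact: ltW.
have [A0|A0] := pselect (A !=set0); last first.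
  exists 0 => // y z Ky Kz; rewrite mul0r addr0; apply: small => // ?.
  by apply: A0; exists (y, z).
have cDA : {within A, continuous D} by apply: continuous_subspaceW cD => x [].
have cgA : {within A, continuous g} by apply: continuous_subspaceW cg => x [].
have [[y0 z0] /set_mem[[/= Ky0 Kz0] ey0]] := compact_EVT_min A0 cA cDA.
have [c /set_mem _] := compact_EVT_max A0 cA cgA.
move=> gmax Dmin.
have delta0 : 0 < D (y0, z0).
  apply: Dgt0 => //; apply/eqP => yz; move: ey0.
  by rewrite /g /= yz subrr normr0 leNgt e0.
have gc0 : 0 <= g c by exact: normr_ge0.
exists (g c / D (y0, z0)) => [|y z Ky Kz]; first by rewrite divr_ge0 // ltW.
have [Ayz|nA] := pselect (A (y, z)); last first.
  apply: (le_trans (small _ _ Ky Kz nA)); rewrite lerDl mulr_ge0 ?D0 //.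
  by rewrite divr_ge0 // ltW.
have := gmax _ (mem_set Ayz); rewrite /g /= => h1.
have h2 := Dmin _ (mem_set Ayz).
apply: (le_trans h1); rewrite -[X in X <= _]add0r; apply: lerD; first exact: ltW.
by rewrite mulrAC ler_pdivlMr // ler_wpM2l.
Qed.

Lemma within_continuous_bounded (f : 'M[R]_(m, n) -> R) :
  {within K, continuous f} -> exists M, forall x, K x -> `|f x| <= M.
Proof.
move=> cf; have [K0|K0] := pselect (K !=set0); last first.
  by exists 0 => x Kx; case: K0; exists x.
have cg : {within K, continuous (fun x => `|f x|)}.
  by move=> x; apply: cvg_norm; exact: cf.
have [c _ cmax] := compact_EVT_max K0 K_compact cg.
by exists `|f c| => x Kx; apply: cmax; exact: mem_set.
Qed.

End Modulus.

(** * Integrals of bounded measurable functions *)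

Section BoundedIntegral.
Context {dX : measure_display} {X : measurableType dX} {R : realType}.
Variables (K : set X).
Hypothesis mK : measurable K.

Definition bounded_meas (f : X -> R) :=
  measurable_fun K f /\ exists M, forall x, K x -> `|f x| <= M.

Lemma bounded_meas_integrable (mu : probability X R) f :
  bounded_meas f -> mu.-integrable K (EFin \o f).
Proof.
move=> [mf [M fM]]; apply: measurable_bounded_integrable => //.
  by apply: (le_lt_trans (probability_le1 mu mK)); rewrite ltry.
by exists M; split; [exact: num_real|move=> N /ltW MN x /fM /le_trans; exact].
Qed.

Lemma bounded_measD f g :
  bounded_meas f -> bounded_meas g -> bounded_meas (fun x => f x + g x).
Proof.
move=> [mf [M fM]] [mg [N gN]]; split; first exact: measurable_funD.
by exists (M + N) => x Kx; rewrite (le_trans (ler_normD _ _)) // lerD ?fM ?gN.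
Qed.

Lemma bounded_measZ c f : bounded_meas f -> bounded_meas (fun x => c * f x).
Proof.
move=> [mf [M fM]]; split; first exact: measurable_funM.
by exists (`|c| * M) => x Kx; rewrite normrM ler_wpM2l ?fM.
Qed.

Lemma bounded_measB f g :
  bounded_meas f -> bounded_meas g -> bounded_meas (fun x => f x - g x).
Proof.
move=> bf /(bounded_measZ (-1)) bg; have := bounded_measD bf bg.
by congr bounded_meas; apply/funext => x; rewrite mulN1r.
Qed.

Lemma bounded_meas_cst c : bounded_meas (fun=> c).
Proof. by split; [exact: measurable_cst|exists `|c|]. Qed.

End BoundedIntegral.

(** Change of variables between subsets: the preimage of [L] contains [K] and exceeds it only by a
    [mu]-null set. *)
Lemma Rintegral_image (dX dY : measure_display) (X : measurableType dX)
    (Y : measurableType dY) (R : realType) (mu : probability X R)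
    (nu : probability Y R) (g : X -> Y) (K : set X) (L : set Y) (f : Y -> R) :
  measurable K -> measurable L -> measurable_fun setT g ->
  (forall A, measurable A -> nu A = mu (g @^-1` A)) -> mu K = 1%E ->
  (forall x, K x -> L (g x)) -> bounded_meas L f ->
  \int[nu]_(y in L) f y = \int[mu]_(x in K) f (g x).
Proof.
move=> mK mL mg nuE muK KL [mf [M fM]].
have mpre : measurable (g @^-1` L) by rewrite -[_ @^-1` _]setTI; exact: mg.
have mfL : measurable_fun setT (f \_ L) by apply/(measurable_restrictT _ mL).
congr fine.
transitivity (\int[nu]_(y in L) ((f \_ L) y)%:E)%E.
  by apply: eq_integral => y yL; rewrite patchE yL.
pose g' : {mfun X >-> Y} := HB.pack g (isMeasurableFun.Build _ _ _ _ g mg).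
rewrite (@eq_measure_integral _ _ _ _ (distribution mu g')); last first.
  by move=> A mA _; exact: nuE.
have bfg : bounded_meas (g @^-1` L) ((f \_ L) \o g).
  split; first exact: (measurable_comp measurableT _ mfL (measurable_funTS mg)).
  by exists M => x Lgx /=; rewrite patchE mem_set //; exact: fM.
have intf := bounded_meas_integrable mpre mu bfg.
rewrite integral_pushforward //; last exact/measurable_EFinP.
rewrite (@negligible_integral _ _ _ mu _ (~` K)) //; last 2 first.
- exact: measurableC.
- by rewrite [LHS](probability_setC mu mK) muK subee.
have -> : (g @^-1` L) `\` ~` K = K.
  by rewrite setDE setCK; apply/seteqP; split => x //= => [[]//|Kx]; split=> //; exact: KL.
by apply: eq_integral => x /set_mem Kx; rewrite /= patchE mem_set //; exact: KL.
Qed.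

(** * Minimizers and Jensen gaps *)

Section Minimizers.
Context {R : realType} {d p : nat}.
Variables (B : set 'rV[R]_d).
Hypotheses (B_compact : compact B) (B_convex : convex_subset B).
Local Notation K := (@set_pow R d p B).
Implicit Types (phi psi w : 'I_p -> 'rV[R]_d -> R) (y z : 'M[R]_(p, d)).

Lemma cvx_contP (f : 'rV[R]_d -> R) :
  cvx_cont B f <-> {within B, continuous f} /\ convex_on B f.
Proof. by split=> -[? ?]; split=> //; exact/convex_functionE. Qed.

Lemma strictly_convex_on (f : 'rV[R]_d -> R) :
  strictly_convex B f -> convex_on B f.
Proof.
move=> sf t x y Bx By /andP[t0 t1].
have [->|xy] := eqVneq x y.
  by rewrite -scalerDl -mulrDl addrC subrK scale1r mul1r.
have [->|tn0] := eqVneq t 0.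
  by rewrite !scale0r subr0 scale1r mul1r !add0r mul0r add0r.
have [->|tn1] := eqVneq t 1.
  by rewrite subrr !scale0r scale1r mul1r !addr0 mul0r addr0.
by apply/ltW/sf => //; rewrite lt_neqAle eq_sym tn0 t0 lt_neqAle tn1.
Qed.

Lemma strictly_convexD (f g : 'rV[R]_d -> R) :
  strictly_convex B f -> convex_on B g -> strictly_convex B (f \+ g).
Proof.
move=> sf cg t x y Bx By xy /andP[t0 t1] /=.
have := sf t x y Bx By xy; rewrite t0 t1 => /(_ isT).
have t01 : 0 <= t <= 1 by rewrite !ltW.
by have := cg t x y Bx By t01; rewrite !mulrDr addrACA; move=> h2 h1; exact: ltr_leD.
Qed.

Lemma convex_on_separable_sum phi :
  (forall i, convex_on B (phi i)) -> convex_on K (separable_sum phi).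
Proof.
move=> cphi t x y Kx Ky t01; rewrite /separable_sum !mulr_sumr -big_split /=.
by apply: ler_sum => i _; rewrite rowD_scale; exact: cphi.
Qed.

Lemma separable_sumD phi psi y :
  separable_sum (fun i => phi i \+ psi i) y =
  separable_sum phi y + separable_sum psi y.
Proof. by rewrite -big_split. Qed.

(** Written with [1 - 2^-1] to be literally the combination of [convex_subset] at [t = 2^-1]. *)
Definition midpoint y z : 'M[R]_(p, d) := 2^-1 *: y + (1 - 2^-1) *: z.

(** The defect in the midpoint convexity inequality. For strictly convex [psi] it is positive off
    the diagonal of [K], so it can replace a distance in [compact_modulus]. *)
Definition jensen_gap psi (yz : 'M[R]_(p, d) * 'M[R]_(p, d)) : R :=
  2^-1 * separable_sum psi yz.1 + (1 - 2^-1) * separable_sum psi yz.2 -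
  separable_sum psi (midpoint yz.1 yz.2).

Let half01 : 0 <= (2^-1 : R) <= 1.
Proof. by apply/andP; split; lra. Qed.

Lemma midpoint_set_pow y z : K y -> K z -> K (midpoint y z).
Proof. by move=> Ky Kz; exact: convex_set_pow. Qed.

Lemma midpoint_splits x y z :
  splits B x y -> splits B x z -> splits B x (midpoint y z).
Proof. by move=> ? ?; exact: convex_splits. Qed.

Lemma jensen_gap_ge0 psi y z : (forall i, convex_on B (psi i)) ->
  K y -> K z -> 0 <= jensen_gap psi (y, z).
Proof. by move=> c Ky Kz; rewrite subr_ge0; exact: convex_on_separable_sum. Qed.

Lemma jensen_gap_gt0 psi y z : (forall i, strictly_convex B (psi i)) ->
  K y -> K z -> y != z -> 0 < jensen_gap psi (y, z).
Proof.
move=> sc Ky Kz yz; rewrite subr_gt0 /=.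
have [i yzi] : exists i, row i y != row i z.
  apply: contrapT => h; move/eqP: yz; apply; apply/row_matrixP => i.
  by apply/eqP/negPn/negP => n; apply: h; exists i.
rewrite /separable_sum !mulr_sumr -big_split /=.
rewrite (bigD1 i) //= [ltRHS](bigD1 i) //=; apply: ltr_leD.
  by rewrite /midpoint rowD_scale; apply: sc => //; apply/andP; split; lra.
apply: ler_sum => k _; rewrite /midpoint rowD_scale.
exact: (strictly_convex_on (sc k)).
Qed.

Lemma within_continuous_jensen_gap psi :
  (forall i, {within B, continuous psi i}) ->
  {within K `*` K, continuous jensen_gap psi}.
Proof.
move=> cpsi; have cP := within_continuous_separable_sum cpsi.
have c1 : {within K `*` K, continuous (separable_sum psi \o fst)}.
  apply: within_continuous_comp_sub cP => [[? ?] []//|].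
  by apply: continuous_subspaceT => x; exact: cvg_fst.
have c2 : {within K `*` K, continuous (separable_sum psi \o snd)}.
  apply: within_continuous_comp_sub cP => [[? ?] []//|].
  by apply: continuous_subspaceT => x; exact: cvg_snd.
have c3 : {within K `*` K, continuous
    (separable_sum psi \o (fun yz => midpoint yz.1 yz.2))}.
  apply: within_continuous_comp_sub cP => [[? ?] [? ?]|].
    exact: midpoint_set_pow.
  apply: continuous_subspaceT => x; apply: cvgD; apply: cvgZr.
    exact: cvg_fst.
  exact: cvg_snd.
move=> x; apply: cvgB; first apply: cvgD.
- by apply: cvgZr; exact: c1.
- by apply: cvgZr; exact: c2.
- exact: c3.
Qed.

Lemma compact_splits x : compact (@splits R d p B x).
Proof.
apply: (subclosed_compact _ (compact_set_pow B_compact)) => [|y []//].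
have -> : splits B x = K `&` @aggregate R d p @^-1` [set x] by [].
apply: closed_within_preimage (closed_set_pow B_compact) _ _.
  exact/continuous_subspaceT/continuous_aggregate.
by apply: compact_closed => //; exact: compact_set1.
Qed.

(** [C] is [setT] for the existence of [T_psi], and the complement of an open set for its
    measurability. *)
Lemma separable_sum_argmin psi x (C : set 'M[R]_(p, d)) :
  (forall i, {within B, continuous psi i}) -> closed C ->
  splits B x `&` C !=set0 ->
  exists y, [/\ splits B x y, C y &
    forall z, splits B x z -> C z -> separable_sum psi y <= separable_sum psi z].
Proof.
move=> cpsi clC ne.
have cC : compact (splits B x `&` C).
  have cx : compact (@splits R d p B x) by exact: compact_splits.
  apply: (subclosed_compact _ cx) => [|y []//].
  by apply: closedI => //; exact: (compact_closed (@norm_hausdorff _ _) cx).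
have cont : {within splits B x `&` C, continuous separable_sum psi}.
  apply: continuous_subspaceW (within_continuous_separable_sum cpsi).
  by move=> y [[]].
have [y /set_mem[yx yC] ymin] := compact_EVT_min ne cC cont.
by exists y; split=> // z zx zC; apply: ymin; exact: mem_set.
Qed.

Section Tpsi.
Variable psi : 'I_p -> 'rV[R]_d -> R.
Hypotheses (psi_cont : forall i, {within B, continuous psi i})
  (psi_sc : forall i, strictly_convex B (psi i)).

Lemma T_psiP x : (@aggregate R d p @` K) x -> minimizers B psi x (T_psi B psi x).
Proof.
move=> [y Ky yx]; apply: getPex.
have [|z [zx _ zmin]] := @separable_sum_argmin psi x setT psi_cont closedT.
  by exists y.
by exists z; split=> // t /zmin; exact.
Qed.

Lemma T_psi_splits y : K y -> splits B (aggregate y) (T_psi B psi (aggregate y)).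
Proof. by move=> Ky; have [] : minimizers B psi _ _ := T_psiP (imageP _ Ky). Qed.

Lemma T_psi_le y : K y ->
  separable_sum psi (T_psi B psi (aggregate y)) <= separable_sum psi y.
Proof. by move=> Ky; have [_] := T_psiP (imageP _ Ky); exact. Qed.

(** Otherwise the midpoint of [y] and [T_psi B psi x], again a split of [x], would have a smaller
    value by strict convexity. *)
Lemma T_psi_unique x y : splits B x y ->
  separable_sum psi y <= separable_sum psi (T_psi B psi x) -> y = T_psi B psi x.
Proof.
move=> yx yle; have [Ky agy] := yx.
have [Tx Tmin] : minimizers B psi x (T_psi B psi x).
  by rewrite -agy; exact: T_psiP (imageP _ Ky).
apply/eqP/negPn/negP => yT.
have := jensen_gap_gt0 psi_sc Ky Tx.1 yT.
have := Tmin _ (midpoint_splits yx Tx); rewrite /jensen_gap /=.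
by move=> h1 h2; lra.
Qed.

Lemma compact_sublevel_aggregate (C : set 'M[R]_(p, d)) (c : R) : closed C ->
  compact (@aggregate R d p @`
    (K `&` separable_sum psi @^-1` [set t | t <= c] `&` C)).
Proof.
move=> clC; apply: continuous_compact.
  exact/continuous_subspaceT/continuous_aggregate.
apply: (subclosed_compact _ (compact_set_pow B_compact)) => [|y [[]]//].
apply: closedI => //; apply: closed_within_preimage (closed_set_pow B_compact) _ _.
  exact: within_continuous_separable_sum.
exact: closed_le.
Qed.

(* [T_psi x] avoids the closed set [C] iff some rational [q] separates the
   minimum over the splits of [x] from the minimum over those lying in [C]. *)
Lemma measurable_T_psi : measurable_fun (@aggregate R d p @` K) (T_psi B psi).
Proof.
move=> mK.
apply: (@measurability _ _ _ _ _ _ (@mx_open R p d)) => //.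
move=> _ [U oU <-].
pose L (C : set 'M[R]_(p, d)) (q : rat) := @aggregate R d p @`
  (K `&` separable_sum psi @^-1` [set t | t <= ratr q] `&` C).
have clU : closed (~` U) by exact: open_closedC.
have -> : (@aggregate R d p @` K) `&` T_psi B psi @^-1` U =
    \bigcup_q (L setT q `\` L (~` U) q).
  apply/seteqP; split => [x [[y Ky yx] UT]|_ [q _ [[y [[Ky yq] _] <-] nL]]].
    have Tx : splits B x (T_psi B psi x) by rewrite -yx; exact: T_psi_splits.
    pose v := separable_sum psi (T_psi B psi x).
    (* [c] is the minimum over the splits of [x] outside [U], or [v + 1] if there are none; by
       uniqueness of the minimizer it exceeds [v]. *)
    have [c [vc cP]] : exists c, v < c /\
        forall z, splits B x z -> (~` U) z -> c <= separable_sum psi z.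
      have [ne|em] := pselect (splits B x `&` ~` U !=set0); last first.
        exists (v + 1); split; first by rewrite ltrDl.
        by move=> z zx zU; case: em; exists z.
      have [z [zx zU zmin]] := separable_sum_argmin psi_cont clU ne.
      exists (separable_sum psi z); split=> //.
      rewrite ltNge; apply/negP => /(T_psi_unique zx) zT.
      by apply: zU; rewrite zT.
    have [q] := rat_in_itvoo vc; rewrite in_itv /= => /andP[vq qc].
    exists q => //; split.
      exists (T_psi B psi x); last by case: Tx.
      by split=> //; split; [case: Tx|exact: ltW].
    move=> [z [[Kz zq] zU] zx].
    have := cP z (conj Kz zx) zU => cz.
    by have := le_lt_trans cz (le_lt_trans zq qc); rewrite ltxx.
  split; first by exists y.
  apply: contrapT => nU; apply: nL; have [KT aT] := T_psi_splits Ky.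
  exists (T_psi B psi (aggregate y)) => //; split=> //.
  by split=> //=; apply: le_trans yq; exact: T_psi_le.
apply: countable_bigcupT_measurable => // q.
by apply: measurableD; apply: compact_mx_measurable;
  apply: compact_sublevel_aggregate => //; exact: closedT.
Qed.

End Tpsi.

(** Minimality of [T_psi] against its midpoint with [y] bounds the gap of [psi] by half the decrease
    of [psi]. That gap is the sum of those of [w] and [phi], the latter nonnegative. *)
Lemma T_psi_jensen_gap w phi y :
  (forall i, {within B, continuous w i}) ->
  (forall i, strictly_convex B (w i)) -> (forall i, cvx_cont B (phi i)) ->
  let psi i := w i \+ phi i in
  K y -> jensen_gap w (y, T_psi B psi (aggregate y)) <=
    2^-1 * (separable_sum psi y -
            separable_sum psi (T_psi B psi (aggregate y))).
Proof.
move=> cw sw cphi psi Ky.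
have cpsi i : {within B, continuous psi i}.
  by move=> x; apply: cvgD; [exact: cw|exact: (cphi i).1].
have phic i : convex_on B (phi i) by have /cvx_contP[] := cphi i.
have [Tx Tmin] := T_psiP cpsi (imageP _ Ky).
set t := T_psi B psi _ in Tx Tmin *.
have := Tmin _ (midpoint_splits (conj Ky erefl) Tx).
have := jensen_gap_ge0 phic Ky Tx.1.
rewrite /jensen_gap /= /psi !separable_sumD => h1 h2.
lra.
Qed.

End Minimizers.

(** * A minimax lemma for two convex functions *)

(** If no point were below [c] for both functions, [key] would say [(c - g b)/(f b - c) <= (g a -
    c)/(c - f a)] whenever [f a < c] and [g b < c]. A number [tau] between the two families of
    ratios gives [tau f + g >= (tau + 1) c] on [C], against the hypothesis at
    [t = tau/(tau + 1)]. *)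
Lemma convex_alternative (R : realType) (V : lmodType R) (C : set V)
    (f g : V -> R) (c : R) :
  convex_subset C -> convex_on C f -> convex_on C g ->
  (forall t, 0 <= t <= 1 -> exists2 x, C x & t * f x + (1 - t) * g x < c) ->
  exists x, [/\ C x, f x < c & g x < c].
Proof.
move=> cC cf cg H; apply: contrapT => nex.
have fg x : C x -> f x < c -> c <= g x.
  by move=> Cx fx; rewrite leNgt; apply/negP => gx; apply: nex; exists x.
have gf x : C x -> g x < c -> c <= f x.
  by move=> Cx gx; rewrite leNgt; apply/negP => fx; apply: nex; exists x.
have key a b : C a -> f a < c -> C b -> g b < c ->
    (c - f a) * (c - g b) <= (f b - c) * (g a - c).
  move=> Ca fa Cb gb; rewrite leNgt; apply/negP => lt.
  have ga := fg _ Ca fa; have fb := gf _ Cb gb.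
  (* [t = u/(u + v)] is the weight at which the chords of [f] and [g] between [a] and [b] meet;
     under [lt] their common value there is below [c]. *)
  set u := (f b - c) + (c - g b); set v := (c - f a) + (g a - c).
  have u0 : 0 < u by rewrite /u; lra.
  have v0 : 0 < v by rewrite /v; lra.
  have uv0 : 0 < u + v by lra.
  have uvn0 : u + v != 0 by rewrite gt_eqF.
  pose t := u / (u + v).
  have t01 : 0 <= t <= 1.
    rewrite /t divr_ge0 ?ler_pdivrMr ?mul1r //=; lra.
  have tE : 1 - t = v / (u + v).
    by rewrite /t -{1}(divff uvn0) -mulrBl addrAC subrr add0r.
  have pt (h : V -> R) : convex_on C h -> u * (h a - c) + v * (h b - c) < 0 ->
      h (t *: a + (1 - t) *: b) < c.
    move=> ch lt0; apply: (le_lt_trans (ch t a b Ca Cb t01)).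
    rewrite tE /t -(ltr_pM2r uv0) mulrDl -!mulrA !(mulrCA _^-1) !(mulrC _^-1).
    rewrite !mulrA !mulfK //; lra.
  apply: nex; exists (t *: a + (1 - t) *: b); split; first exact: cC.
    by apply: pt => //; rewrite /u /v; lra.
  by apply: pt => //; rewrite /u /v; lra.
have [a Ca fa] : exists2 a, C a & f a < c.
  have [|a Ca] := H 1; first by rewrite ler01 lexx.
  by rewrite mul1r subrr mul0r addr0; exists a.
have [b Cb gb] : exists2 b, C b & g b < c.
  have [|b Cb] := H 0; first by rewrite ler01 lexx.
  by rewrite mul0r subr0 mul1r add0r; exists b.
(* If [f b' = c], the right side of [key] would be zero and its left side positive; so the ratios in
   [Q] have positive denominators. *)
have fb0 b' : C b' -> g b' < c -> 0 < f b' - c.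
  move=> Cb' gb'; have := key _ _ Ca fa Cb' gb'.
  have : 0 < (c - f a) * (c - g b') by rewrite mulr_gt0 // subr_gt0.
  have := gf _ Cb' gb'; rewrite le_eqVlt => /predU1P[<-|]; last by rewrite subr_gt0.
  by rewrite subrr mul0r; lra.
pose Q := [set (c - g b') / (f b' - c) | b' in [set b' | C b' /\ g b' < c]].
have Qub a' : C a' -> f a' < c -> ubound Q ((g a' - c) / (c - f a')).
  move=> Ca' fa' _ [b' [Cb' gb'] <-].
  rewrite ler_pdivrMr ?fb0 // mulrAC ler_pdivlMr ?subr_gt0 //.
  by have := key _ _ Ca' fa' Cb' gb'; lra.
have Qsup : has_sup Q.
  split; first by exists ((c - g b) / (f b - c)), b.
  by exists ((g a - c) / (c - f a)); exact: Qub.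
pose tau := sup Q.
have tau_ge b' : C b' -> g b' < c -> (c - g b') <= tau * (f b' - c).
  move=> Cb' gb'; rewrite -ler_pdivrMr ?fb0 //.
  by apply: ub_le_sup; [case: Qsup|exists b'].
have tau_le a' : C a' -> f a' < c -> tau * (c - f a') <= g a' - c.
  move=> Ca' fa'; rewrite -ler_pdivlMr ?subr_gt0 //.
  by apply: ge_sup; [case: Qsup|exact: Qub].
have tau0 : 0 <= tau.
  have h := tau_ge _ Cb gb; rewrite -(@pmulr_lge0 _ (f b - c)) ?fb0 //; lra.
have tau1 : 0 < tau + 1 by lra.
have [|x Cx] := H (tau / (tau + 1)).
  by rewrite divr_ge0 ?ler_pdivrMr ?mul1r //=; lra.
have tau1n : tau + 1 != 0 by rewrite gt_eqF.
rewrite -(ltr_pM2r tau1).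
have -> : (tau / (tau + 1) * f x + (1 - tau / (tau + 1)) * g x) * (tau + 1) =
    tau * f x + g x by field.
apply/negP; rewrite -leNgt.
have [fx|fx] := ltP (f x) c; first by have := tau_le _ Cx fx; lra.
have [gx|gx] := ltP (g x) c; first by have := tau_ge _ Cx gx; lra.
by have : 0 <= tau * (f x - c) by [rewrite mulr_ge0 // subr_ge0]; lra.
Qed.

(** * Laws of admissible maps *)

Section Laws.
Context {R : realType} {d p : nat}.
Variables (B : set 'rV[R]_d).
Hypotheses (B_compact : compact B) (B_convex : convex_subset B).
Hypothesis p0 : (0 < p)%N.
Local Notation K := (@set_pow R d p B).
Implicit Types (phi psi w : 'I_p -> 'rV[R]_d -> R).
Implicit Types (m : probability 'rV[R]_d R) (gamma nu : probability 'M[R]_(p, d) R).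

Let mK : measurable K. Proof. exact: measurable_set_pow. Qed.

Lemma bounded_meas_continuous (f : 'M[R]_(p, d) -> R) :
  {within K, continuous f} -> bounded_meas K f.
Proof.
move=> cf; split; first exact: within_continuous_measurable_fun.
exact: within_continuous_bounded (compact_set_pow B_compact) _ cf.
Qed.

Lemma bounded_meas_separable_sum phi :
  (forall i, {within B, continuous phi i}) -> bounded_meas K (separable_sum phi).
Proof.
by move=> cphi; apply: bounded_meas_continuous;
  exact: within_continuous_separable_sum.
Qed.

(** The complement of [K] is open and null, so the support is a closed subset of [K]: the
    compactness demanded of an allocation is automatic for laws carried by [K]. *)
Lemma compact_msupport gamma : gamma K = 1%E -> compact (msupport gamma).
Proof.
move=> gK; have clK : closed K by exact: closed_set_pow.
apply: (subclosed_compact _ (compact_set_pow B_compact)) => [|x xs].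
  rewrite -[X in closed X]setCK closedC openE => x /= nx.
  have [U [oU Ux] U0] : exists2 U, open_nbhs x U & ~ (0 < gamma U)%E.
    by apply: contrapT => h; apply: nx => U xU; apply: contrapT => g0; apply: h; exists U.
  rewrite /interior; apply: filterS (open_nbhs_nbhs (conj oU Ux)) => y Uy ys.
  by apply: U0; exact: ys.
apply: contrapT => nKx.
have := xs (~` K) (conj (closed_openC clK) nKx).
by rewrite [X in (_ < X)%E](probability_setC gamma mK) gK subee // ltxx.
Qed.

Lemma probability_eq_on gamma A1 A2 : measurable A1 -> measurable A2 ->
  gamma K = 1%E -> A1 `&` K = A2 `&` K -> gamma A1 = gamma A2.
Proof.
move=> m1 m2 gK AK.
have gI A : measurable A -> gamma A = gamma (A `&` K).
  move=> mA; have AK0 : gamma (A `\` K) = 0%E.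
    have sub : A `\` K `<=` ~` K by move=> x [].
    apply: (subset_measure0 (measurableD mA mK) (measurableC mK) sub).
    by rewrite [LHS](probability_setC gamma mK) gK subee.
  by rewrite [LHS](measureDI gamma mA mK) [X in (X + _)%E]AK0 add0e.
by rewrite (gI _ m1) (gI _ m2) AK.
Qed.

(** Measurable on the whole space so that image measures exist; the values off [K] are free, as the
    laws considered are carried by [K]. *)
Definition admissible (S : 'M[R]_(p, d) -> 'M[R]_(p, d)) : Prop :=
  measurable_fun setT S /\ forall x, K x -> splits B (aggregate x) (S x).

Lemma admissible_id : admissible id.
Proof. by split=> // x Kx; split. Qed.

Lemma measurable_fun_mxD (S1 S2 : 'M[R]_(p, d) -> 'M[R]_(p, d)) (s t : R) :
  measurable_fun setT S1 -> measurable_fun setT S2 ->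
  measurable_fun setT (fun x => s *: S1 x + t *: S2 x).
Proof.
move=> /measurable_fun_mxP-/(_ measurableT) m1 /measurable_fun_mxP-/(_ measurableT) m2.
apply/measurable_fun_mxP => // i j; under eq_fun do rewrite !mxE.
by apply: measurable_funD; apply: measurable_funM.
Qed.

Lemma convex_admissible :
  convex_subset (admissible : set ('M[R]_(p, d) -> 'M[R]_(p, d))).
Proof.
move=> t S1 S2 [m1 s1] [m2 s2] t01; split; first exact: measurable_fun_mxD.
by move=> x Kx; apply: convex_splits => //; [exact: s1|exact: s2].
Qed.

Lemma admissible_set_pow S x : admissible S -> K x -> K (S x).
Proof. by move=> [_ sS] /sS []. Qed.

Lemma bounded_meas_admissible (f : 'M[R]_(p, d) -> R) S :
  {within K, continuous f} -> admissible S ->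
  bounded_meas K (fun x => f (S x)).
Proof.
move=> /bounded_meas_continuous[mf [M fM]] aS; split.
  apply: (measurable_comp mK _ mf (measurable_funTS aS.1)).
  by move=> _ [x Kx <-]; exact: admissible_set_pow.
by exists M => x Kx; apply: fM; exact: admissible_set_pow.
Qed.

(** [aggregate \o S] and [aggregate] agree on [K], which has full measure, so the law of the
    aggregate is unchanged. *)
Lemma admissible_law m gamma S : allocation_in B m gamma -> admissible S ->
  exists2 nu, allocation_in B m nu &
    forall f : 'M[R]_(p, d) -> R, {within K, continuous f} ->
      \int[nu]_(x in K) f x = \int[gamma]_(x in K) f (S x).
Proof.
move=> [[_ gm] gK] [mS aS].
pose S' : {mfun 'M[R]_(p, d) >-> 'M[R]_(p, d)} :=
  HB.pack S (isMeasurableFun.Build _ _ _ _ S mS).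
have mpre A : measurable A -> measurable (S @^-1` A).
  by move=> mA; rewrite -[_ @^-1` _]setTI; exact: (mS measurableT).
have magg A : measurable A -> measurable (@aggregate R d p @^-1` A).
  move=> mA; rewrite -[_ @^-1` _]setTI.
  by apply: continuous_mx_measurable_fun => //; exact: continuous_aggregate.
have nK : distribution gamma S' K = 1%E.
  rewrite -gK; apply: (@probability_eq_on gamma (S @^-1` K) K) => //; first exact: mpre.
  by apply/seteqP; split => x [h Kx]; split=> //; exact: (aS _ Kx).1.
exists (distribution gamma S').
  split=> //; split; first exact: compact_msupport nK.
  move=> A mA; rewrite -gm //.
  apply: (@probability_eq_on gamma (S @^-1` (@aggregate R d p @^-1` A))
    (@aggregate R d p @^-1` A)) => //.
  - by apply: mpre; exact: magg.
  - exact: magg.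
  - by apply/seteqP; split => x [h Kx]; split=> //; move: h;
      rewrite /= (aS _ Kx).2.
move=> f cf; apply: Rintegral_image => //; first by move=> x /aS[].
exact: bounded_meas_continuous.
Qed.

Section AdmissibleTpsi.
Variable psi : 'I_p -> 'rV[R]_d -> R.
Hypotheses (psi_cont : forall i, {within B, continuous psi i})
  (psi_sc : forall i, strictly_convex B (psi i)).

(** Off [K] the aggregate may have no split, and [T_psi] is then an arbitrary value; the identity
    keeps the map measurable everywhere. *)
Definition T_map (x : 'M[R]_(p, d)) : 'M[R]_(p, d) :=
  if x \in K then T_psi B psi (aggregate x) else x.

Lemma T_mapE x : K x -> T_map x = T_psi B psi (aggregate x).
Proof. by move=> Kx; rewrite /T_map mem_set. Qed.

Lemma admissible_T_map : admissible T_map.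
Proof.
split; last by move=> x Kx; rewrite T_mapE //; exact: T_psi_splits.
have Kpre : (fun x => x \in K) @^-1` [set true] = K.
  by apply/seteqP; split => x /=; [move=> /set_mem|move=> /mem_set].
apply: measurable_fun_if => //.
- by apply: (@measurable_fun_bool _ _ _ _ true); rewrite setTI Kpre.
- rewrite setTI Kpre.
  apply: (measurable_comp _ _
    (measurable_T_psi B_compact B_convex psi_cont psi_sc)) => //.
  + apply: compact_mx_measurable.
    apply: continuous_compact (compact_set_pow B_compact).
    exact/continuous_subspaceT/continuous_aggregate.
  + apply: measurable_funTS; apply: continuous_mx_measurable_fun.
    exact: continuous_aggregate.
Qed.

(** [m] is the image of any allocation under [aggregate]; the integral against [gamma] is therefore
    the same for all allocations. *)
Lemma Rintegral_T_psi m gamma (f : 'M[R]_(p, d) -> R) : allocation_in B m gamma ->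
  {within K, continuous f} ->
  \int[m]_(x in dilate p%:R B) f (T_psi B psi x) =
  \int[gamma]_(y in K) f (T_psi B psi (aggregate y)).
Proof.
move=> [[_ gm] gK] cf; rewrite dilate_aggregate //.
have mD : measurable (@aggregate R d p @` K).
  apply: compact_mx_measurable; apply: continuous_compact (compact_set_pow B_compact).
  exact/continuous_subspaceT/continuous_aggregate.
have [mf [M fM]] := bounded_meas_continuous cf.
apply: Rintegral_image => //.
- by apply: continuous_mx_measurable_fun; exact: continuous_aggregate.
- by move=> A mA; rewrite -gm.
split.
  apply: (measurable_comp mK _ mf) => [_ [_ [y Ky <-] <-]|].
    by case: (T_psi_splits B_compact psi_cont Ky).
  exact: measurable_T_psi.
by exists M => _ [y Ky <-]; apply: fM; case: (T_psi_splits B_compact psi_cont Ky).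
Qed.

End AdmissibleTpsi.

(** [psi], being [w] plus a convex family, is itself a strictly convex test family. For every
    allocation [nu], [\int psi dgamma] equals the integral of [psi (T_psi (aggregate y))] against
    [nu], which is at most [\int psi dnu] by minimality. *)
Lemma strictly_comonotone_efficient m w gamma :
  (forall i, strictly_convex B (w i)) ->
  strictly_comonotone B m w gamma -> efficient B m gamma.
Proof.
move=> scw [ag [psi [cpsi cpw gpsi]]]; split=> // -[nu [anu [_ sd]]].
have scpsi i : strictly_convex B (psi i).
  have := strictly_convexD (scw i) (proj2 ((cvx_contP _ _).1 (cpw i))).
  by congr strictly_convex; apply/funext => x /=; rewrite addrC subrK.
have cont i : {within B, continuous psi i} by case: (cpsi i).
have cP := within_continuous_separable_sum cont.
have := sd psi cpsi scpsi.
rewrite (gpsi _ cP) (Rintegral_T_psi cont scpsi anu cP) ltNge => /negP; apply.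
apply: le_Rintegral => //.
- apply: bounded_meas_integrable => //.
  have := bounded_meas_admissible cP (admissible_T_map cont scpsi).
  case=> mf [M fM]; split.
    apply: eq_measurable_fun mf => x /set_mem Kx; by rewrite T_mapE.
  by exists M => x Kx; have := fM _ Kx; rewrite T_mapE.
- by apply: bounded_meas_integrable => //; exact: bounded_meas_separable_sum.
- by move=> y Ky; exact: T_psi_le.
Qed.

End Laws.

(** * L^2 completeness of admissible maps *)

(** Bounds by [rate n] stay summable, with total 1, after multiplication by [2^n]. *)
Definition rate {R : realType} (n : nat) : R :=
  (2 ^ n)%:R^-1 * (2 ^ n.+1)%:R^-1.

Lemma rate_gt0 {R : realType} n : 0 < rate n :> R.
Proof. by rewrite /rate mulr_gt0 // invr_gt0 ltr0n expn_gt0. Qed.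

Lemma rate_antitone {R : realType} n : rate n.+1 <= rate n :> R.
Proof.
rewrite /rate ler_pM ?invr_ge0 ?ler0n // lef_pV2 ?posrE ?ltr0n ?expn_gt0 //.
  by rewrite ler_nat leq_exp2l.
by rewrite ler_nat leq_exp2l.
Qed.

Lemma cvg_rate {R : realType} : (rate n : R) @[n --> \oo] --> 0.
Proof.
apply: (@squeeze_cvgr _ _ _ _ (fun=> 0) (fun n => n.+1%:R^-1)).
- near=> n; rewrite ltW ?rate_gt0 //=.
  rewrite /rate -[leRHS]mul1r ler_pM ?invr_ge0 ?ler0n //.
    by rewrite invf_le1 ?ltr0n ?expn_gt0 // ler1n expn_gt0.
  by rewrite lef_pV2 ?posrE ?ltr0n ?expn_gt0 // ler_nat ltnW // ltn_expl.
- exact: cvg_cst.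
- exact: cvg_harmonic.
Unshelve. all: by end_near. Qed.

(** By monotone convergence the sum of the series has integral at most 1, hence is finite off a null
    set; there the nondecreasing partial sums are bounded. *)
Lemma ae_summable (dX : measure_display) (X : measurableType dX) (R : realType)
    (mu : probability X R) (K : set X) (q : nat -> X -> R) : measurable K ->
  (forall n, bounded_meas K (q n)) -> (forall n x, K x -> 0 <= q n x) ->
  (forall n, \int[mu]_(x in K) q n x <= (2 ^ n.+1)%:R^-1) ->
  exists N, [/\ measurable N, mu N = 0%E &
    forall x, K x -> ~ N x -> cvgn (series (fun n => q n x))].
Proof.
move=> mK bq q0 iq.
have int_q n : mu.-integrable K (EFin \o q n) by exact: bounded_meas_integrable.
pose Q x := (\sum_(0 <= n <oo) (q n x)%:E)%E.
have mQ : measurable_fun K Q.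
  by apply: ge0_emeasurable_sum => [n x Kx _|n _]; [rewrite lee_fin q0|
    exact/measurable_EFinP/(bq n).1].
have Q0 x : K x -> (0 <= Q x)%E.
  by move=> Kx; apply: nneseries_ge0 => n _ _; rewrite lee_fin q0.
have intQ : mu.-integrable K Q.
  apply/integrableP; split => //.
  have -> : (\int[mu]_(x in K) `|Q x| = \int[mu]_(x in K) Q x)%E.
    by apply: eq_integral => x /set_mem Kx; rewrite gee0_abs ?Q0.
  have mq n : measurable_fun K (fun x => (q n x)%:E).
    exact/measurable_EFinP/(bq n).1.
  have q0' n x : K x -> (0 <= (q n x)%:E)%E by rewrite lee_fin; exact: q0.
  rewrite (integral_nneseries mu mK mq q0').
  apply: (@le_lt_trans _ _ 1%E); last exact: ltry.
  apply: le_trans (@epsilon_trick0 R 1 xpredT ler01).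
  apply: lee_nneseries => n _.
    by move=> _; apply: integral_ge0 => x Kx; rewrite lee_fin q0.
  have -> : (\int[mu]_(x in K) (q n x)%:E)%E = (\int[mu]_(x in K) q n x)%:E.
    by rewrite /Rintegral fineK //; exact: (integrable_fin_num mK (int_q n)).
  by rewrite lee_fin div1r.
have [N [mN muN sN]] := integrable_ae mK intQ.
exists N; split=> // x Kx nN.
have finQ : Q x \is a fin_num.
  by apply: contrapT => h; apply: nN; apply: sN => /= /(_ Kx).
apply: nondecreasing_is_cvgn.
  by apply: nondecreasing_series => n _ _; exact: q0.
exists (fine (Q x)) => _ [n _ <-].
rewrite -lee_fin fineK // /series /= -sumEFin.
by apply: nneseries_lim_ge => k _ _; rewrite lee_fin q0.
Qed.

(** * Squared Euclidean distance between matrices *)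

Section SquaredDistance.
Context {R : realType} {m n : nat}.
Implicit Types (y z : 'M[R]_(m, n)).

(** The square of the Frobenius distance, which, unlike the sup norm, satisfies the parallelogram
    identity; it takes a pair so as to be a [D] of [compact_modulus]. *)
Definition sqdist (yz : 'M[R]_(m, n) * 'M[R]_(m, n)) : R :=
  \sum_i \sum_j (yz.1 i j - yz.2 i j) ^+ 2.

Lemma sqdist_ge0 y z : 0 <= sqdist (y, z).
Proof. by do 2![apply: sumr_ge0 => ? _]; exact: sqr_ge0. Qed.

Lemma sqdist_coord y z i j : (y i j - z i j) ^+ 2 <= sqdist (y, z).
Proof.
rewrite /sqdist (bigD1 i) //= (bigD1 j) //= -addrA lerDl addr_ge0 //.
  by apply: sumr_ge0 => ? _; exact: sqr_ge0.
by do 2![apply: sumr_ge0 => ? _]; exact: sqr_ge0.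
Qed.

Lemma sqdist_gt0 y z : y != z -> 0 < sqdist (y, z).
Proof.
move=> yz; rewrite lt_neqAle sqdist_ge0 andbT eq_sym.
apply: contra yz => /eqP e; apply/eqP/matrixP => i j; apply/eqP.
by rewrite -subr_eq0 -sqrf_eq0 eq_le sqr_ge0 -[X in _ <= X]e sqdist_coord.
Qed.

Lemma sqdist_parallelogram y z :
  sqdist (y, z) = 2 * sqdist (y, 0) + 2 * sqdist (z, 0) -
                  4 * sqdist (midpoint y z, 0).
Proof.
rewrite /sqdist !mulr_sumr -!big_split -sumrB; apply: eq_bigr => i _ /=.
rewrite !mulr_sumr -!big_split -sumrB; apply: eq_bigr => j _ /=.
by rewrite !mxE; field.
Qed.

Lemma cvg_sqdist (S : Type) (F : set_system S) {FF : Filter F}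
    (f g : S -> 'M[R]_(m, n)) y z :
  f x @[x --> F] --> y -> g x @[x --> F] --> z ->
  sqdist (f x, g x) @[x --> F] --> sqdist (y, z).
Proof.
move=> fy gz; apply: cvg_sumr => i; apply: cvg_sumr => j /=.
have fij : f x i j @[x --> F] --> y i j.
  apply: (@cvg_comp _ _ _ f (fun M => M i j) F (nbhs y) (nbhs (y i j)) fy).
  exact: coord_continuous.
have gij : g x i j @[x --> F] --> z i j.
  apply: (@cvg_comp _ _ _ g (fun M => M i j) F (nbhs z) (nbhs (z i j)) gz).
  exact: coord_continuous.
have h : (f x i j - g x i j) @[x --> F] --> y i j - z i j by exact: cvgB.
by rewrite expr2; under eq_fun do rewrite expr2; exact: cvgM.
Qed.

Lemma continuous_sqdist : continuous sqdist.
Proof.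
by move=> [y z]; apply: (@cvg_sqdist _ (nbhs (y, z)));
  [exact: cvg_fst|exact: cvg_snd].
Qed.

End SquaredDistance.

(** * Integrals of admissible maps against a fixed law *)

Section Integrals.
Context {R : realType} {d p : nat}.
Variables (B : set 'rV[R]_d).
Hypotheses (B_compact : compact B) (B_convex : convex_subset B).
Local Notation M := 'M[R]_(p, d).
Local Notation K := (@set_pow R d p B).
Local Notation admissible := (@admissible R d p B).
Variable gamma : probability M R.
Hypothesis gamma_K : gamma K = 1%E.
Implicit Types (phi psi w : 'I_p -> 'rV[R]_d -> R) (S : M -> M).

Let mK : measurable K. Proof. exact: measurable_set_pow. Qed.

Definition intK (f : M -> R) : R := \int[gamma]_(x in K) f x.

Lemma intKD f g : bounded_meas K f -> bounded_meas K g ->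
  intK (fun x => f x + g x) = intK f + intK g.
Proof. by move=> bf bg; apply: RintegralD => //; exact: bounded_meas_integrable. Qed.

Lemma intKB f g : bounded_meas K f -> bounded_meas K g ->
  intK (fun x => f x - g x) = intK f - intK g.
Proof. by move=> bf bg; apply: RintegralB => //; exact: bounded_meas_integrable. Qed.

Lemma intKZ c f : bounded_meas K f -> intK (fun x => c * f x) = c * intK f.
Proof. by move=> bf; apply: RintegralZl => //; exact: bounded_meas_integrable. Qed.

Lemma intK_cst c : intK (fun=> c) = c.
Proof. by rewrite /intK Rintegral_cst // [X in fine X]gamma_K mulr1. Qed.

Lemma le_intK f g : bounded_meas K f -> bounded_meas K g ->
  (forall x, K x -> f x <= g x) -> intK f <= intK g.
Proof. by move=> bf bg; apply: le_Rintegral => //; exact: bounded_meas_integrable. Qed.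

Lemma eq_intK f g : (forall x, K x -> f x = g x) -> intK f = intK g.
Proof. by move=> fg; apply: eq_Rintegral => x /set_mem; exact: fg. Qed.

Lemma intK_ge0 f : (forall x, K x -> 0 <= f x) -> 0 <= intK f.
Proof. by move=> f0; exact: Rintegral_ge0. Qed.

Lemma ler_norm_intK f : bounded_meas K f -> `|intK f| <= intK (fun x => `|f x|).
Proof. by move=> bf; apply: le_normr_Rintegral => //; exact: bounded_meas_integrable. Qed.

Lemma bounded_meas_norm (f : M -> R) :
  bounded_meas K f -> bounded_meas K (fun x => `|f x|).
Proof.
move=> [mf [C fC]]; split; first exact: measurableT_comp.
by exists C => x Kx; rewrite normr_id fC.
Qed.

Lemma sqdist_bounded : exists C, forall y z, K y -> K z -> sqdist (y, z) <= C.
Proof.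
have cKK : compact (K `*` K) by apply: compact_setX; exact: compact_set_pow.
have [K0|K0] := pselect (K `*` K !=set0); last first.
  by exists 0 => y z Ky Kz; case: K0; exists (y, z).
have [c _ cmax] := compact_EVT_max K0 cKK
  (continuous_subspaceT (@continuous_sqdist R p d)).
by exists (sqdist c) => y z Ky Kz; apply: cmax; apply: mem_set.
Qed.

Lemma bounded_meas_sqdist S1 S2 : admissible S1 -> admissible S2 ->
  bounded_meas K (fun x => sqdist (S1 x, S2 x)).
Proof.
move=> a1 a2; split.
  apply: measurable_sum => i; apply: measurable_sum => j /=.
  apply: measurable_funX; apply: measurable_funB; apply: measurable_funTS.
    exact: (measurable_fun_mxP _ measurableT).1 a1.1 i j.
  exact: (measurable_fun_mxP _ measurableT).1 a2.1 i j.
have [C HC] := sqdist_bounded.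
exists C => x Kx; rewrite ger0_norm ?sqdist_ge0 //.
by apply: HC; exact: admissible_set_pow.
Qed.

Lemma bounded_meas_jensen_gap psi S1 S2 :
  (forall i, {within B, continuous psi i}) -> admissible S1 -> admissible S2 ->
  bounded_meas K (fun x => jensen_gap psi (S1 x, S2 x)).
Proof.
move=> cpsi a1 a2; have cP := within_continuous_separable_sum cpsi.
have am : admissible (2^-1 *: S1 + (1 - 2^-1) *: S2).
  by apply: convex_admissible => //; apply/andP; split; lra.
by apply: bounded_measB; first apply: bounded_measD; try apply: bounded_measZ;
  exact: (bounded_meas_admissible B_compact cP).
Qed.

(** [compact_modulus] integrated. [C] does not depend on the maps, so maps that are close in the
    mean of [D] give close integrals of [f]. *)
Lemma intK_modulus (f : M -> R) (D : M * M -> R) (e : R) :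
  {within K, continuous f} -> {within K `*` K, continuous D} ->
  (forall y z, K y -> K z -> 0 <= D (y, z)) ->
  (forall y z, K y -> K z -> y != z -> 0 < D (y, z)) -> 0 < e ->
  exists2 C, 0 <= C & forall S1 S2, admissible S1 -> admissible S2 ->
    bounded_meas K (fun x => D (S1 x, S2 x)) ->
    `|intK (fun x => f (S2 x)) - intK (fun x => f (S1 x))| <=
      e + C * intK (fun x => D (S1 x, S2 x)).
Proof.
move=> cf cD D0 Dgt0 e0.
have [C C0 HC] := compact_modulus (compact_set_pow B_compact) cf cD D0 Dgt0 e0.
exists C => // S1 S2 a1 a2 bD.
have b1 := bounded_meas_admissible B_compact cf a1.
have b2 := bounded_meas_admissible B_compact cf a2.
rewrite -intKB // -[X in _ <= X + _]intK_cst -intKZ // -intKD //; last first.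
- exact: bounded_measZ.
- exact: bounded_meas_cst.
apply: le_trans (ler_norm_intK (bounded_measB b2 b1)) _.
apply: le_intK.
- by apply: bounded_meas_norm; exact: bounded_measB.
- by apply: bounded_measD; [exact: bounded_meas_cst|exact: bounded_measZ].
by move=> x Kx; apply: HC; exact: admissible_set_pow.
Qed.

(** Almost everywhere, [2^n] times the squared distances is summable; by [|a| <= 2^n a^2 + 2^-n] the
    entries then have summable increments and converge. The limit is admissible because the splits
    of a point form a closed set, and dominated convergence gives the L^2 limit. *)
Lemma admissible_complete (S : nat -> M -> M) :
  (forall n, admissible (S n)) ->
  (forall n, intK (fun x => sqdist (S n x, S n.+1 x)) <= rate n) ->
  exists2 T, admissible T &
    intK (fun x => sqdist (S n x, T x)) @[n --> \oo] --> 0.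
Proof.
move=> aS Srate.
pose q n x := (2 ^ n)%:R * sqdist (S n x, S n.+1 x).
have bq n : bounded_meas K (q n).
  by apply: bounded_measZ; exact: bounded_meas_sqdist.
have q0 n x : K x -> 0 <= q n x.
  by move=> _; rewrite mulr_ge0 ?ler0n ?sqdist_ge0.
have iq n : \int[gamma]_(x in K) q n x <= (2 ^ n.+1)%:R^-1.
  rewrite -[X in X <= _]/(intK _) intKZ; last exact: bounded_meas_sqdist.
  rewrite mulrC -ler_pdivlMr ?ltr0n ?expn_gt0 //.
  by rewrite mulrC; exact: Srate.
have [N [mN N0 Ncvg]] := ae_summable mK bq q0 iq.
have S_cvg x i j : K x -> ~ N x -> cvgn (fun n => S n x i j).
  move=> Kx nN.
  have -> : (fun n => S n x i j) =
      (fun n => S 0%N x i j + series (telescope (fun n => S n x i j)) n).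
    by apply/funext => n; rewrite -eq_sum_telescope.
  apply: is_cvgD; first exact: is_cvg_cst.
  apply: normed_cvg.
  have cg : cvgn (series (fun n => q n x + geometric 1 2^-1 n)).
    apply: is_cvg_seriesD; first exact: Ncvg.
    by apply: is_cvg_geometric_series; rewrite ger0_norm; lra.
  apply: series_le_cvg cg => n //=.
    by rewrite addr_ge0 ?q0 //= mul1r exprn_ge0.
  rewrite /telescope /= mul1r.
  set a := S n.+1 x i j - S n x i j.
  have qa : (2 ^ n)%:R * a ^+ 2 <= q n x.
    by rewrite ler_pM2l ?ltr0n ?expn_gt0 // -sqrrN opprB; exact: sqdist_coord.
  apply: le_trans (lerD qa (lexx _)).
  rewrite natrX exprVn -real_normK ?num_real //.
  have := normr_ge0 a; set b := `|a|; set t := 2 ^+ n => b0.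
  have t0 : 0 < t by rewrite exprn_gt0.
  (* Expanding this square gives [2 b <= t b^2 + t^-1]. *)
  have : 0 <= t * (b - t^-1) ^+ 2 by rewrite mulr_ge0 ?sqr_ge0 // ltW.
  have -> : t * (b - t^-1) ^+ 2 = t * b ^+ 2 - 2 * b + t^-1.
    by field; rewrite gt_eqF.
  by lra.
(* Replacing [S n] by the identity off [K] and on the null set [N] makes the limit exist everywhere,
   so that [T] is measurable and splits correctly at every point of [K]. *)
pose v n x := if x \in K `\` N then S n x else x.
pose T x : M := \matrix_(i, j) lim (v n x i j @[n --> \oo]).
have vS n x : K x -> ~ N x -> v n x = S n x.
  by move=> Kx nN; rewrite /v mem_set.
have vT x : v n x @[n --> \oo] --> T x.
  apply: cvg_mx => i j; rewrite mxE.
  suff : cvgn (fun n => v n x i j) by [].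
  have [/set_mem[Kx Nx]|nx] := boolP (x \in K `\` N).
    rewrite (_ : (fun n => _) = fun n => S n x i j); first exact: S_cvg.
    by apply/funext => n; rewrite vS.
  rewrite (_ : (fun n => _) = fun n => x i j); first exact: is_cvg_cst.
  by apply/funext => n; rewrite /v (negbTE nx).
have mKN : measurable (K `\` N) by exact: measurableD.
have KNpre : (fun x => x \in K `\` N) @^-1` [set true] = K `\` N.
  by apply/seteqP; split => x /=; [move=> /set_mem|move=> /mem_set].
have mv n : measurable_fun setT (v n).
  apply: measurable_fun_if => //.
    by apply: (@measurable_fun_bool _ _ _ _ true); rewrite setTI KNpre.
  exact: measurable_funTS (aS n).1.
have aT : admissible T.
  split.
    apply/measurable_fun_mxP => // i j.
    apply: (@measurable_fun_cvg _ _ _ _ (fun n x => v n x i j)).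
      by move=> n; exact: (measurable_fun_mxP _ measurableT).1 (mv n) i j.
    move=> x _; apply: (@cvg_comp _ _ _ (fun n => v n x) (fun M => M i j) \oo
      (nbhs (T x)) (nbhs (T x i j)) (vT x)).
    exact: coord_continuous.
  move=> x Kx.
  have cl : closed (@splits R d p B (aggregate x)).
    have cs : compact (@splits R d p B (aggregate x)) by exact: compact_splits.
    exact: (compact_closed (@norm_hausdorff _ _) cs).
  apply: (@closed_cvg _ _ \oo _ (fun n => v n x) _ cl _ (T x) (vT x)).
  apply: nearW => n; rewrite /v.
  by case: ifP => _; [exact: (aS n).2|split].
exists T => //.
have bST n := bounded_meas_sqdist (aS n) aT.
have [C HC] := sqdist_bounded.
have [] := @dominated_convergence _ _ _ gamma K mK
  (fun n x => (sqdist (S n x, T x))%:E) (fun=> 0%E) (fun=> C%:E).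
- by move=> n; apply/measurable_EFinP; exact: (bST n).1.
- exact: measurable_cst.
- exists N; split=> // x /= h; apply: contrapT => nN; apply: h => Kx.
  apply: cvg_EFin; first exact: nearW.
  rewrite (_ : 0 = sqdist (T x, T x)); last first.
    rewrite /sqdist big1 // => i _; rewrite big1 // => j _.
    by rewrite subrr expr0n.
  apply: cvg_trans (cvg_sqdist (vT x) (cvg_cst (T x))).
  by apply: near_eq_cvg; apply: nearW => n; rewrite vS.
- by apply: bounded_meas_integrable => //; exact: bounded_meas_cst.
- apply: aeW => x n Kx; rewrite /= lee_fin ger0_norm ?sqdist_ge0 //.
  by apply: HC; exact: admissible_set_pow.
move=> _ _; rewrite integral0 => /fine_cvg; exact.
Qed.

End Integrals.

(** * The minimax argument *)

Section Minimax.
Context {R : realType} {d p : nat}.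
Variables (B : set 'rV[R]_d).
Hypotheses (B_compact : compact B) (B_convex : convex_subset B).
Local Notation M := 'M[R]_(p, d).
Local Notation K := (@set_pow R d p B).
Local Notation admissible := (@admissible R d p B).
Variable gamma : probability M R.
Hypothesis gamma_K : gamma K = 1%E.
Variable w : 'I_p -> 'rV[R]_d -> R.
Hypotheses (w_cont : forall i, {within B, continuous w i})
  (w_sc : forall i, strictly_convex B (w i)).
Local Notation intK := (intK B gamma).
Implicit Types (phi : 'I_p -> 'rV[R]_d -> R) (S : M -> M).

Definition cone phi := forall i, cvx_cont B (phi i).

Definition perturb phi i : 'rV[R]_d -> R := w i \+ phi i.

Lemma cone_cont phi i : cone phi -> {within B, continuous phi i}.
Proof. by move=> /(_ i)[]. Qed.

Lemma cone_convex phi i : cone phi -> convex_on B (phi i).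
Proof. by move=> /(_ i)/cvx_contP[]. Qed.

Lemma perturb_cont phi i : cone phi -> {within B, continuous perturb phi i}.
Proof. by move=> cphi x; apply: cvgD; [exact: w_cont|exact: cone_cont]. Qed.

Lemma perturb_sc phi i : cone phi -> strictly_convex B (perturb phi i).
Proof. by move=> cphi; apply: strictly_convexD; [|exact: cone_convex]. Qed.

Lemma perturb_convex phi i : cone phi -> convex_on B (perturb phi i).
Proof. by move=> cphi; apply: strictly_convex_on; exact: perturb_sc. Qed.

Lemma perturb_sum_cont phi :
  cone phi -> {within K, continuous separable_sum (perturb phi)}.
Proof.
by move=> cphi; apply: within_continuous_separable_sum => i; exact: perturb_cont.
Qed.

Lemma cone0 : cone (fun _ _ => 0).
Proof.
move=> i; apply/cvx_contP; split.
  by apply: continuous_subspaceT; exact: cst_continuous.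
by move=> t x y _ _ _; rewrite !mulr0 addr0.
Qed.

Lemma coneD phi1 phi2 (s t : R) : cone phi1 -> cone phi2 -> 0 <= s -> 0 <= t ->
  cone (fun i x => s * phi1 i x + t * phi2 i x).
Proof.
move=> c1 c2 s0 t0 i; apply/cvx_contP; split.
  by move=> x; apply: cvgD; apply: cvgZr; [exact: cone_cont i c1 x|exact: cone_cont i c2 x].
move=> u x y Bx By u01.
have h1 := ler_wpM2l s0 (cone_convex i c1 Bx By u01).
have h2 := ler_wpM2l t0 (cone_convex i c2 Bx By u01).
by apply: (le_trans (lerD h1 h2)); rewrite le_eqVlt; apply/predU1P; left; ring.
Qed.

(** The payoff of the game: convex in [S], affine in [phi], and zero at [S = id]. *)
Definition excess phi S : R :=
  intK (fun x => separable_sum (perturb phi) (S x)) -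
  intK (separable_sum (perturb phi)).

Lemma bounded_meas_perturb phi S : cone phi -> admissible S ->
  bounded_meas K (fun x => separable_sum (perturb phi) (S x)).
Proof. by move=> /perturb_sum_cont; exact: bounded_meas_admissible. Qed.

Lemma excess_convex phi : cone phi ->
  convex_on (admissible : set (M -> M)) (excess phi).
Proof.
move=> cphi t S1 S2 a1 a2 t01.
have b1 := bounded_meas_perturb cphi a1.
have b2 := bounded_meas_perturb cphi a2.
have a12 := convex_admissible B_convex a1 a2 t01.
have b12 := bounded_meas_perturb cphi a12.
have : intK (fun x => separable_sum (perturb phi) (t *: S1 x + (1 - t) *: S2 x)) <=
    t * intK (fun x => separable_sum (perturb phi) (S1 x)) +
    (1 - t) * intK (fun x => separable_sum (perturb phi) (S2 x)).
  rewrite -!intKZ // -intKD //; [|exact: bounded_measZ|exact: bounded_measZ].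
  apply: le_intK => //.
    by apply: bounded_measD; exact: bounded_measZ.
  move=> x Kx; apply: convex_on_separable_sum => //.
  - by move=> i; exact: perturb_convex.
  - exact: admissible_set_pow a1 Kx.
  - exact: admissible_set_pow a2 Kx.
by rewrite /excess => h; apply: le_trans (lerB h (lexx _)) _; lra.
Qed.

Lemma excess_affine phi1 phi2 (t : R) S : cone phi1 -> cone phi2 ->
  admissible S ->
  excess (fun i x => t * phi1 i x + (1 - t) * phi2 i x) S =
  t * excess phi1 S + (1 - t) * excess phi2 S.
Proof.
move=> c1 c2 aS.
have sE y : separable_sum
    (perturb (fun i x => t * phi1 i x + (1 - t) * phi2 i x)) y =
    t * separable_sum (perturb phi1) y + (1 - t) * separable_sum (perturb phi2) y.
  rewrite /separable_sum !mulr_sumr -big_split; apply: eq_bigr => i _ /=.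
  by rewrite /perturb /=; ring.
have IE T : admissible T -> intK (fun x => separable_sum
    (perturb (fun i x => t * phi1 i x + (1 - t) * phi2 i x)) (T x)) =
    t * intK (fun x => separable_sum (perturb phi1) (T x)) +
    (1 - t) * intK (fun x => separable_sum (perturb phi2) (T x)).
  move=> aT; have b1 := bounded_meas_perturb c1 aT.
  have b2 := bounded_meas_perturb c2 aT.
  rewrite -!intKZ // -intKD //; [|exact: bounded_measZ|exact: bounded_measZ].
  by apply: eq_intK => x _; exact: sE.
rewrite /excess (IE _ aS) (IE id (admissible_id B)); ring.
Qed.

Definition energy S : R := intK (fun x => sqdist (S x, 0)).

Lemma bounded_meas_sqnorm S :
  admissible S -> bounded_meas K (fun x => sqdist (S x, 0)).
Proof.
apply: (@bounded_meas_admissible _ _ _ _ B_compact (fun y => sqdist (y, 0))).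
apply: continuous_subspaceT => y.
by apply: (@cvg_sqdist _ _ _ _ (nbhs y)); [exact: cvg_id|exact: cvg_cst].
Qed.

Lemma energy_ge0 S : 0 <= energy S.
Proof. by apply: intK_ge0 => x _; exact: sqdist_ge0. Qed.

Lemma energy_bounded : exists C, forall S, admissible S -> energy S <= C.
Proof.
have [_ [C HC]] := bounded_meas_sqnorm (admissible_id B).
exists C => S aS; rewrite -(intK_cst B_compact gamma_K C); apply: le_intK => //.
- exact: bounded_meas_sqnorm.
- exact: bounded_meas_cst.
- by move=> x Kx; apply: le_trans (ler_norm _) (HC _ _); exact: admissible_set_pow.
Qed.

Lemma energy_parallelogram S1 S2 : admissible S1 -> admissible S2 ->
  intK (fun x => sqdist (S1 x, S2 x)) =
  2 * energy S1 + 2 * energy S2 -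
  4 * energy (2^-1 *: S1 + (1 - 2^-1) *: S2).
Proof.
move=> a1 a2; have b1 := bounded_meas_sqnorm a1; have b2 := bounded_meas_sqnorm a2.
have a12 : admissible (2^-1 *: S1 + (1 - 2^-1) *: S2).
  by apply: convex_admissible => //; apply/andP; split; lra.
have b12 := bounded_meas_sqnorm a12.
have c1 := bounded_measZ 2 b1; have c2 := bounded_measZ 2 b2.
have c12 := bounded_measZ 4 b12.
rewrite /energy -!intKZ // -intKD // -intKB //; last exact: bounded_measD.
by apply: eq_intK => x _; exact: sqdist_parallelogram.
Qed.

Variable eps : R.
Hypothesis excess_lt : forall phi, cone phi ->
  exists2 S, admissible S & excess phi S < - eps.

(* Convex sets of maps over which the lower value of the game is still below
   [- eps]; cutting such a set by one more payoff preserves the property. *)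
Definition good (C : set (M -> M)) : Prop :=
  [/\ convex_subset C, C `<=` admissible &
    forall phi, cone phi -> exists2 S, C S & excess phi S < - eps].

Lemma good_admissible : good admissible.
Proof. by split=> //; exact: convex_admissible. Qed.

(** For a further [phi'], [convex_alternative] is applied to the payoffs of [phi] and [phi'] on [C]:
    by affinity their combination with weight [t] is the payoff of the combined family, which is
    below [- eps] somewhere on [C]. *)
Lemma good_cut C phi : good C -> cone phi ->
  good (C `&` [set S | excess phi S < - eps]).
Proof.
move=> [cC Ca Cex] cphi; split=> [t S1 S2 [C1 e1] [C2 e2] /= t01|S []|phi' cphi'].
- split; first exact: cC.
  apply: le_lt_trans (excess_convex cphi (Ca _ C1) (Ca _ C2) t01) _.
  move: t01 => /andP[t0 t1]; move: e1 e2 => /=; set a := excess _ S1.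
  set b := excess _ S2 => a1 b1.
  have [->|tn0] := eqVneq t 0; first by rewrite mul0r add0r subr0 mul1r.
  have h1 : t * a < t * - eps by rewrite ltr_pM2l // lt_neqAle eq_sym tn0.
  have h2 : (1 - t) * b <= (1 - t) * - eps by rewrite ler_wpM2l ?subr_ge0 // ltW.
  by apply: (lt_le_trans (ltr_leD h1 h2)); rewrite -mulrDl addrC subrK mul1r.
- by move=> /Ca.
have conv phi0 : cone phi0 -> convex_on C (excess phi0).
  by move=> c0 t S1 S2 /Ca a1 /Ca a2; exact: excess_convex.
have [|S [CS e1 e2]] :=
    convex_alternative (c := - eps) cC (conv _ cphi) (conv _ cphi').
  move=> t /andP[t0 t1].
  have [|S CS] := Cex (fun i x => t * phi i x + (1 - t) * phi' i x).
    by apply: coneD => //; rewrite subr_ge0.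
  by rewrite excess_affine //; [exists S|exact: Ca].
by exists S.
Qed.

Definition lower_energies C : set R :=
  [set t | exists C', [/\ good C', C' `<=` C & forall S, C' S -> t <= energy S]].

(** The best lower bound on the energy obtainable by shrinking [C] to a good subset. Once a good
    subset nearly attains it, further cuts can hardly raise the least energy. *)
Definition value C : R := sup (lower_energies C).

Lemma good_neq0 C : good C -> C !=set0.
Proof. by move=> [_ _ /(_ _ cone0)[S]]; exists S. Qed.

Lemma has_sup_lower_energies C : good C -> has_sup (lower_energies C).
Proof.
move=> gC; split.
  by exists 0, C; split=> // S _; exact: energy_ge0.
have [D HD] := energy_bounded; exists D => t [C' [gC' _ tC']].
have [S C'S] := good_neq0 gC'; apply: (le_trans (tC' _ C'S)).
by apply: HD; case: gC' => _ + _; exact.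
Qed.

(** Otherwise [C] itself would make [value C + e] a lower energy. *)
Lemma value_near C (e : R) : good C -> 0 < e ->
  exists2 S, C S & energy S < value C + e.
Proof.
move=> gC e0; apply: contrapT => h.
have : value C + e <= value C.
  apply: ub_le_sup; first by case: (has_sup_lower_energies gC).
  exists C; split=> // S CS; rewrite leNgt; apply/negP => lt.
  by apply: h; exists S.
by rewrite leNgt ltrDl e0.
Qed.

Lemma value_antitone C C' : good C -> good C' -> C' `<=` C -> value C' <= value C.
Proof.
move=> gC gC' C'C; apply: ge_sup; first by case: (has_sup_lower_energies gC').
move=> t [C'' [gC'' C''C' tC'']].
apply: ub_le_sup; first by case: (has_sup_lower_energies gC).
by exists C''; split=> // S /C''C' /C'C.
Qed.

Lemma value_step C (e : R) : good C -> 0 < e ->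
  exists C', [/\ good C', C' `<=` C & forall S, C' S -> value C - e <= energy S].
Proof.
move=> gC e0.
have [t [C' [gC' C'C tC']] /ltW et] := sup_adherent e0 (has_sup_lower_energies gC).
by exists C'; split=> // S /tC'; exact: le_trans.
Qed.

(** The midpoint lies in [C] and has energy at least [s - e]; the parallelogram identity gives the
    bound [4 (s + e) - 4 (s - e) = 8 e]. *)
Lemma good_close C (s e : R) S1 S2 : good C ->
  (forall S, C S -> s - e <= energy S) -> C S1 -> C S2 ->
  energy S1 < s + e -> energy S2 < s + e ->
  intK (fun x => sqdist (S1 x, S2 x)) <= 8 * e.
Proof.
move=> [cC Ca _] sC C1 C2 e1 e2.
rewrite energy_parallelogram; [|exact: Ca|exact: Ca].
have := sC _ (cC 2^-1 _ _ C1 C2 _).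
have h : 0 <= (2^-1 : R) <= 1 by apply/andP; split; lra.
by move=> /(_ h); lra.
Qed.

(** The good sets [Cs n] are shrunk until the energies on [Cs n.+1] are nearly at least
    [value (Cs n)]; near-minimizers in [Cs n.+1] are then close in L^2, and the [S n] converge to
    some [T]. For a given [phi], the cut of [Cs n.+1] by its payoff is still good and has a
    near-minimizer [S'], close to [S n] and so to [T]: in the limit the payoff of [T] is at most
    [- eps]. *)
Lemma minimax : exists2 S, admissible S &
  forall phi, cone phi -> excess phi S <= - eps.
Proof.
(* The 8 cancels that of [good_close], leaving [rate n]. *)
pose e n : R := rate n / 8.
have e0 n : 0 < e n by rewrite /e divr_gt0 // rate_gt0.
have /choice[next nextP] : forall Cn : set (M -> M) * nat, exists C', good Cn.1 ->
    [/\ good C', C' `<=` Cn.1 &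
        forall S, C' S -> value Cn.1 - e Cn.2 <= energy S].
  move=> [C n]; have [gC|nC] := pselect (good C); last by exists C.
  by have [C' C'P] := value_step gC (e0 n); exists C'.
pose Cs := fix Cs n := if n is k.+1 then next (Cs k, k) else admissible.
have gCs n : good (Cs n).
  by elim: n => [|n IH]; [exact: good_admissible|case: (nextP (Cs n, n) IH)].
have subC n : Cs n.+1 `<=` Cs n by case: (nextP (Cs n, n) (gCs n)).
have lowC n S : Cs n.+1 S -> value (Cs n) - e n <= energy S.
  by case: (nextP (Cs n, n) (gCs n)) => _ _; exact.
(* A good subset has a smaller or equal [value], so near-minimizers in any cut of [Cs n.+1] are
   near-minimal at the level [value (Cs n)]. *)
have near_min n C : good C -> C `<=` Cs n.+1 ->
    exists2 S, C S & energy S < value (Cs n) + e n.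
  move=> gC CC; have [S CS lt] := value_near gC (e0 n); exists S => //.
  apply: (lt_le_trans lt); rewrite lerD2r; apply: value_antitone => //.
  by move=> T /CC; exact: subC.
have /choice[S SP] : forall n, exists S, Cs n.+1 S /\ energy S < value (Cs n) + e n.
  by move=> n; have [S] := near_min n _ (gCs n.+1) (@subset_refl _ _); exists S.
have adm n T : Cs n T -> admissible T by case: (gCs n) => _ + _; exact.
have close n T1 T2 : Cs n.+1 T1 -> Cs n.+1 T2 ->
    energy T1 < value (Cs n) + e n -> energy T2 < value (Cs n) + e n ->
    intK (fun x => sqdist (T1 x, T2 x)) <= rate n.
  move=> C1 C2 e1 e2; have := good_close (gCs n.+1) (@lowC n) C1 C2 e1 e2.
  by rewrite /e mulrCA divff ?mulr1.
have aS n : admissible (S n) by exact: adm _ _ (SP n).1.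
have cS n : intK (fun x => sqdist (S n x, S n.+1 x)) <= rate n.
  have [C1 e1] := SP n; have [C2 e2] := SP n.+1.
  apply: close => //; first exact: subC.
  apply: (lt_le_trans e2); apply: lerD; first exact: value_antitone.
  by rewrite /e ler_pM2r ?invr_gt0 // rate_antitone.
have [T aT ST] := admissible_complete B_compact aS cS.
exists T => // phi cphi; apply/ler_addgt0Pr => eta eta0.
(* Two thirds pay for the moduli from [S'] to [S n] and from [S n] to [T], the last for the squared
   distances multiplied by [C]. *)
have eta3 : 0 < eta / 3 by lra.
have [C C0 HC] := intK_modulus B_compact gamma_K (perturb_sum_cont cphi)
  (continuous_subspaceT (@continuous_sqdist R p d))
  (fun y z _ _ => sqdist_ge0 y z) (fun y z _ _ => @sqdist_gt0 _ _ _ y z) eta3.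
have lim0 : C * (intK (fun x => sqdist (S n x, T x)) + rate n) @[n --> \oo] --> 0.
  rewrite -(mulr0 C) -[X in C * X](addr0 0).
  by apply: cvgM; [exact: cvg_cst|apply: cvgD; [exact: ST|exact: cvg_rate]].
have [n nlt] := filter_ex (cvgr_lt _ lim0 _ eta3).
have gcut := good_cut (gCs n.+1) cphi.
have [S' [CS' exS'] eS'] := near_min n _ gcut (@subIsetl _ _ _).
have aS' := adm _ _ CS'.
have h1 := HC _ _ (aS n) aT (bounded_meas_sqdist B_compact (aS n) aT).
have h2 := HC _ _ aS' (aS n) (bounded_meas_sqdist B_compact aS' (aS n)).
have h3 := close _ _ _ CS' (SP n).1 eS' (SP n).2.
have h4 := ler_wpM2l C0 h3.
move: exS' h1 h2 nlt; rewrite /= /excess !ler_norml mulrDr.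
by move=> h5 /andP[_ h1] /andP[_ h2] h6; lra.
Qed.

End Minimax.

(** * Efficient allocations as limits of strictly comonotone ones *)

Section Comonotone.
Context {R : realType} {d p : nat}.
Variables (B : set 'rV[R]_d).
Hypotheses (B_compact : compact B) (B_convex : convex_subset B).
Hypothesis p0 : (0 < p)%N.
Local Notation M := 'M[R]_(p, d).
Local Notation K := (@set_pow R d p B).
Variable m : probability 'rV[R]_d R.
Variable w : 'I_p -> 'rV[R]_d -> R.
Hypotheses (w_cont : forall i, {within B, continuous w i})
  (w_sc : forall i, strictly_convex B (w i)).
Implicit Types (gamma : probability M R) (phi : 'I_p -> 'rV[R]_d -> R).

(** Otherwise [minimax] gives a map [S] with payoff at most [- e] against every [phi]. Large
    multiples of [phi] force [S] not to increase [\int phi], and [phi = 0] shows that [S] decreases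
    [\int w] by at least [e], so that it differs from the identity in the mean. *)
Lemma efficient_excess gamma (e : R) : efficient B m gamma -> 0 < e ->
  exists2 phi, cone B phi &
    forall S, admissible B S -> - e <= excess B gamma w phi S.
Proof.
move=> [ag neff] e0; have gK := ag.2.
apply: contrapT => nex.
have [phi cphi|S aS exS] := minimax (eps := e) B_compact B_convex gK w_cont w_sc.
  apply: contrapT => h; apply: nex; exists phi => // S aS.
  by rewrite leNgt; apply/negP => lt; apply: h; exists S.
have wP := within_continuous_separable_sum w_cont.
have bP phi T : cone B phi -> admissible B T ->
    bounded_meas K (fun x => separable_sum phi (T x)).
  move=> cphi aT; apply: bounded_meas_admissible => //.
  by apply: within_continuous_separable_sum => i; case: (cphi i).
have bw T : admissible B T -> bounded_meas K (fun x => separable_sum w (T x)).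
  by move=> aT; exact: bounded_meas_admissible.
have excessE phi : cone B phi -> excess B gamma w phi S =
    (intK B gamma (fun x => separable_sum w (S x)) -
     intK B gamma (separable_sum w)) +
    (intK B gamma (fun x => separable_sum phi (S x)) -
     intK B gamma (separable_sum phi)).
  move=> cphi; rewrite /excess.
  have E T : admissible B T ->
      intK B gamma (fun x => separable_sum (perturb w phi) (T x)) =
      intK B gamma (fun x => separable_sum w (T x)) +
      intK B gamma (fun x => separable_sum phi (T x)).
    move=> aT; rewrite -intKD //; [|exact: bw|exact: bP].
    by apply: eq_intK => x _; exact: separable_sumD.
  by rewrite (E S aS) (E id (admissible_id B)); ring.
have decr phi : cone B phi -> intK B gamma (fun x => separable_sum phi (S x)) <=
    intK B gamma (separable_sum phi).
  move=> cphi; rewrite -subr_le0 leNgt; apply/negP; set b := _ - _ => b0.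
  (* With this [k], [k * b] is the absolute value of the change of [\int w], so the payoff of
     [k phi] is nonnegative, against [exS]. *)
  pose k := (`|intK B gamma (fun x => separable_sum w (S x)) -
     intK B gamma (separable_sum w)| / b).
  have k0 : 0 <= k by rewrite divr_ge0 // ltW.
  have ck : cone B (fun i x => k * phi i x + 0 * phi i x) by exact: coneD.
  have sE y : separable_sum (fun i x => k * phi i x + 0 * phi i x) y =
      k * separable_sum phi y.
    by rewrite /separable_sum mulr_sumr; apply: eq_bigr => i _; rewrite mul0r addr0.
  have := exS _ ck; rewrite excessE //.
  have -> : intK B gamma (fun x =>
      separable_sum (fun i x => k * phi i x + 0 * phi i x) (S x)) =
      k * intK B gamma (fun x => separable_sum phi (S x)).
    by rewrite -intKZ; [apply: eq_intK => x _; exact: sE|exact: B_compact|exact: bP].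
  have -> : intK B gamma (separable_sum (fun i x => k * phi i x + 0 * phi i x)) =
      k * intK B gamma (separable_sum phi).
    rewrite -intKZ; [by apply: eq_intK => x _; exact: sE|exact: B_compact|].
    exact: (bP _ id cphi (admissible_id B)).
  rewrite -mulrBr -/b /k divfK ?gt_eqF //.
  set a := _ - _; have := ler_norm (- a); rewrite normrN; lra.
have a_lt : intK B gamma (fun x => separable_sum w (S x)) -
     intK B gamma (separable_sum w) <= - e.
  have := exS _ (@cone0 _ _ _ B); rewrite excessE; last exact: cone0.
  have E T : intK B gamma (fun x =>
      separable_sum (fun _ : 'I_p => (fun=> 0) : 'rV[R]_d -> R) (T x)) = 0.
    rewrite -[RHS](intK_cst B_compact gK 0); apply: eq_intK => x _.
    by rewrite /separable_sum big1.
  by rewrite (E S) subrr addr0.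
pose S2 := 2^-1 *: S + (1 - 2^-1) *: (id : M -> M).
have half01 : 0 <= (2^-1 : R) <= 1 by apply/andP; split; lra.
have aS2 : admissible B S2.
  exact: (convex_admissible B_convex aS (admissible_id B) half01).
have [nu anu nuE] := admissible_law B_compact ag aS2.
apply: neff; exists nu; split => //.
have gapE phi : cone B phi ->
    intK B gamma (fun x => separable_sum phi (S2 x)) =
    2^-1 * intK B gamma (fun x => separable_sum phi (S x)) +
    (1 - 2^-1) * intK B gamma (separable_sum phi) -
    intK B gamma (fun x => jensen_gap phi (S x, x)).
  move=> cphi; have b1 := bP _ _ cphi aS; have b2 := bP _ id cphi (admissible_id B).
  have c1 := bounded_measZ 2^-1 b1; have c2 := bounded_measZ (1 - 2^-1) b2.
  rewrite -!intKZ // -intKD // -intKB //; last 2 first.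
  - exact: bounded_measD.
  - apply: (bounded_meas_jensen_gap B_compact B_convex _ aS (admissible_id B)).
    by move=> i; case: (cphi i).
  by apply: eq_intK => x _; rewrite /jensen_gap /=; lra.
have sumP phi : cone B phi -> {within K, continuous separable_sum phi}.
  by move=> cphi; apply: within_continuous_separable_sum => i; case: (cphi i).
split=> phi cphi.
  rewrite (nuE _ (sumP _ cphi)) -[X in X <= _]/(intK _ _ _).
  rewrite -[X in _ <= X]/(intK B gamma (separable_sum phi)) gapE //.
  have := decr _ cphi => h.
  have : 0 <= intK B gamma (fun x => jensen_gap phi (S x, x)).
    apply: intK_ge0 => x Kx.
    exact: (jensen_gap_ge0 (fun i => cone_convex i cphi)
      (admissible_set_pow aS Kx) Kx).
  by lra.
move=> scphi.
rewrite (nuE _ (sumP _ cphi)) -[X in X < _]/(intK _ _ _).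
rewrite -[X in _ < X]/(intK B gamma (separable_sum phi)) gapE //.
have := decr _ cphi.
suff : 0 < intK B gamma (fun x => jensen_gap phi (S x, x)) by lra.
have cphi' i : {within B, continuous phi i} by case: (cphi i).
have e2 : 0 < e / 2 by lra.
(* The variation of [w] is measured by the gap of [phi]: [e] is at most the decrease of [\int w],
   itself at most [e/2] plus [C] times the integrated gap, which is thus positive. *)
have [C C0 HC] := intK_modulus B_compact gK wP
  (within_continuous_jensen_gap B_convex cphi')
  (fun y z Ky Kz => jensen_gap_ge0 (fun i => cone_convex i cphi) Ky Kz)
  (fun y z Ky Kz => jensen_gap_gt0 scphi Ky Kz) e2.
have := HC _ _ aS (admissible_id B)
  (bounded_meas_jensen_gap B_compact B_convex cphi' aS (admissible_id B)).
rewrite ler_norml => /andP[_ h].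
have h2 : 0 < C * intK B gamma (fun x => jensen_gap phi (S x, x)) by lra.
have Cn0 : C != 0 by apply/eqP => C00; move: h2; rewrite C00 mul0r ltxx.
by rewrite pmulr_rgt0 // lt_neqAle eq_sym Cn0 in h2.
Qed.

Lemma strictly_comonotone_T_map gamma phi : allocation_in B m gamma ->
  cone B phi -> exists2 nu, strictly_comonotone B m w nu &
    forall f : M -> R, {within K, continuous f} ->
      \int[nu]_(x in K) f x =
      intK B gamma (fun x => f (T_map B (perturb w phi) x)).
Proof.
move=> ag cphi.
have cpsi i : {within B, continuous perturb w phi i} by exact: perturb_cont.
have spsi i : strictly_convex B (perturb w phi i) by exact: perturb_sc.
have aT := admissible_T_map B_compact B_convex cpsi spsi.
have [nu anu nuE] := admissible_law B_compact ag aT.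
exists nu => //; split=> //; exists (perturb w phi); split.
- by move=> i; apply/cvx_contP; split=> //; exact: strictly_convex_on.
- move=> i; rewrite (_ : _ \- _ = phi i) //.
  by apply/funext => x; rewrite /perturb /= addrAC subrr add0r.
- move=> f cf; rewrite nuE // (Rintegral_T_psi B_compact B_convex p0 cpsi spsi ag cf).
  by apply: eq_intK => x Kx; rewrite T_mapE.
Qed.

(** The payoff against [T_map] being at least [-1/(n+1)], the map decreases [\int (w + phi)] by at
    most [1/(n+1)]. By [T_psi_jensen_gap] the integrated gap of [w] between the identity and [T_map]
    tends to 0, and [f] is controlled by that gap. *)
Lemma efficient_approx gamma : efficient B m gamma ->
  exists g : nat -> probability M R,
    (forall n, strictly_comonotone B m w (g n)) /\
    forall f : M -> R, {within K, continuous f} ->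
      \int[g n]_(x in K) f x @[n --> \oo] --> \int[gamma]_(x in K) f x.
Proof.
move=> eg; have ag := eg.1; have gK := ag.2.
have /choice[g gP] : forall n : nat, exists nu : probability M R,
    strictly_comonotone B m w nu /\ exists phi, [/\ cone B phi,
      forall S, admissible B S -> - n.+1%:R^-1 <= excess B gamma w phi S &
      forall f : M -> R, {within K, continuous f} ->
      \int[nu]_(x in K) f x =
      intK B gamma (fun x => f (T_map B (perturb w phi) x))].
  move=> n; have n0 : 0 < n.+1%:R^-1 :> R by rewrite invr_gt0.
  have [phi cphi exphi] := efficient_excess eg n0.
  have [nu snu nuE] := strictly_comonotone_T_map ag cphi.
  by exists nu; split=> //; exists phi.
exists g; split=> [n|f cf]; first by case: (gP n).
apply/cvgrPdist_le => e e0; have e2 : 0 < e / 2 by lra.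
have wcv i : convex_on B (w i) by exact: strictly_convex_on.
have [C C0 HC] := intK_modulus B_compact gK cf
  (within_continuous_jensen_gap B_convex w_cont)
  (fun y z Ky Kz => jensen_gap_ge0 wcv Ky Kz)
  (fun y z Ky Kz => jensen_gap_gt0 w_sc Ky Kz) e2.
have inv0 : (n.+1%:R^-1 : R) @[n --> \oo] --> 0 by exact: cvg_harmonic.
have lim0 : (C * n.+1%:R^-1) @[n --> \oo] --> 0.
  by rewrite -(mulr0 C); exact: (cvgM (cvg_cst C) inv0).
near=> n; have nlt : C * n.+1%:R^-1 < e / 2.
  by near: n; exact: (cvgr_lt _ lim0 _ e2).
have [_ [phi [cphi exphi gE]]] := gP n.
rewrite gE // distrC.
have cpsi i : {within B, continuous perturb w phi i} by exact: perturb_cont.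
have spsi i : strictly_convex B (perturb w phi i) by exact: perturb_sc.
have aT := admissible_T_map B_compact B_convex cpsi spsi.
have bgap := bounded_meas_jensen_gap B_compact B_convex w_cont (admissible_id B) aT.
have := HC _ _ (admissible_id B) aT bgap.
move=> /le_trans; apply.
have Psi_cont := within_continuous_separable_sum cpsi.
have b1 := bounded_meas_admissible B_compact Psi_cont aT.
have b2 := bounded_meas_admissible B_compact Psi_cont (admissible_id B).
have gap_le : intK B gamma (fun x => jensen_gap w (x, T_map B (perturb w phi) x)) <=
    2^-1 * (intK B gamma (separable_sum (perturb w phi)) -
     intK B gamma (fun x => separable_sum (perturb w phi) (T_map B (perturb w phi) x))).
  rewrite -intKB // -intKZ //; last exact: bounded_measB.
  apply: le_intK => //; first by apply: bounded_measZ; exact: bounded_measB.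
  by move=> x Kx; rewrite T_mapE //; exact: T_psi_jensen_gap.
have := exphi _ aT; rewrite /excess => h.
have ng : 0 <= n.+1%:R^-1 :> R by rewrite invr_ge0.
have : intK B gamma (fun x => jensen_gap w (x, T_map B (perturb w phi) x)) <= n.+1%:R^-1.
  by move: h gap_le ng; move: (n.+1%:R^-1 : R) => t; lra.
move=> /(ler_wpM2l C0) h'; apply: le_trans (lerD (lexx _) h') _.
by move: nlt; move: (C * _) => t; lra.
Unshelve. all: by end_near. Qed.

End Comonotone.

(** * Weak star closure and sequences *)

Section WeakStar.
Context {R : realType} {d p : nat}.
Variables (B : set 'rV[R]_d).
Hypotheses (B_compact : compact B) (B_convex : convex_subset B).
Local Notation M := 'M[R]_(p, d).
Local Notation K := (@set_pow R d p B).
Implicit Types (gamma nu : probability M R).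

(** In a topology induced from a product space, convergence is that of every coordinate, here of
    every [\int f]. *)
Lemma weak_star_cvg (g : nat -> probability M R) gamma :
  (forall f : M -> R, {within K, continuous f} ->
    \int[g n]_(x in K) f x @[n --> \oo] --> \int[gamma]_(x in K) f x) ->
  (g : nat -> weak_star B) @ \oo --> (gamma : weak_star B).
Proof.
move=> H.
have Hp : cont_fun_int (B := B) (g n) @[n --> \oo] -->
    (cont_fun_int (B := B) gamma : {ptws cont_fun B -> R}).
  apply/cvg_sup => f U /= [_ [[V oV <-] Vx WU]].
  apply: filterS WU _.
  by apply: (H _ (svalP f)); exact: open_nbhs_nbhs.
move=> A /= [_ [[V oV <-] Vg WA]].
have nV : nbhs (cont_fun_int (B := B) gamma : {ptws cont_fun B -> R}) V.
  exact: open_nbhs_nbhs.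
have [N _ VN] := Hp V nV; exists N => // n Nn.
by apply: WA; exact: VN.
Qed.

Lemma weak_star_nbhs gamma (f : M -> R) (e : R) : {within K, continuous f} -> 0 < e ->
  nbhs (gamma : weak_star B) [set nu |
    `|\int[nu]_(x in K) f x - \int[gamma]_(x in K) f x| < e].
Proof.
move=> cf e0; pose F : cont_fun B := exist _ f cf.
have c : continuous (fun nu : weak_star B => cont_fun_int (B := B) nu F).
  move=> nu; apply: (@continuous_comp _ _ _ (@cont_fun_int R d p B : weak_star B -> _)
    (fun h : {ptws cont_fun B -> R} => h F)).
    exact: initial_continuous.
  exact: proj_continuous.
have /cvgrPdist_lt/(_ e e0) := c gamma.
by apply: filterS => nu /=; rewrite distrC.
Qed.

Lemma finite_net (e : R) : 0 < e ->
  exists2 s : seq M, (forall c, c \in s -> K c) &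
    forall x, K x -> exists2 c, c \in s & `|x - c| < e.
Proof.
move=> e0; have := compact_set_pow B_compact (p := p).
rewrite compact_cover => /(_ M K (fun c => ball c e)) [c Kc|x Kx|D DK KD].
- exact: ball_open.
- by exists x => //; exact: ballxx.
exists (finmap.enum_fset D) => [c cD|x Kx].
  by apply/set_mem; exact: DK.
have [c /= cD] := KD x Kx; rewrite -ball_normE /= => xc.
by exists c => //; rewrite distrC.
Qed.

Definition hat (e : R) (c x : M) : R := Num.max 0 (e - `|x - c|).

Lemma hat_ge0 e c x : 0 <= hat e c x.
Proof. by rewrite le_max lexx. Qed.

Lemma continuous_hat e c : continuous (hat e c).
Proof.
move=> x; have h : {for x, continuous (fun y : M => e - `|y - c|)}.
  apply: (@cvgB _ _ _ (nbhs x)); first exact: cvg_cst.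
  apply: cvg_norm; apply: (@cvgB _ _ _ (nbhs x)); first exact: cvg_id.
  exact: cvg_cst.
apply: (@continuous_max R M (fun=> 0) _ x _ h); exact: cst_continuous.
Qed.

Lemma hat_gt0 e c x : (0 < hat e c x) = (`|x - c| < e).
Proof. by rewrite lt_max ltxx subr_gt0. Qed.

Definition hat_sum (e : R) (s : seq M) (x : M) : R := \sum_(c <- s) hat e c x.

(** Normalized tents: as [c] runs through a net [s] of mesh [e], a partition of unity on [K]
    subordinate to the balls of radius [e]. *)
Definition bump (e : R) (s : seq M) (c x : M) : R := hat e c x / hat_sum e s x.

Section Bump.
Variables (e : R) (s : seq M).
Hypotheses (sK : forall c, c \in s -> K c)
  (s_net : forall x, K x -> exists2 c, c \in s & `|x - c| < e).

Lemma hat_sum_gt0 x : K x -> 0 < hat_sum e s x.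
Proof.
move=> /s_net[c cs xc]; rewrite /hat_sum (big_rem c) //=.
by rewrite ltr_pwDl ?hat_gt0 // sumr_ge0 // => ? _; exact: hat_ge0.
Qed.

Lemma bump_ge0 c x : K x -> 0 <= bump e s c x.
Proof. by move=> Kx; rewrite divr_ge0 ?hat_ge0 // ltW // hat_sum_gt0. Qed.

Lemma sum_bump x : K x -> \sum_(c <- s) bump e s c x = 1.
Proof. by move=> Kx; rewrite -mulr_suml divff // gt_eqF // hat_sum_gt0. Qed.

Lemma within_continuous_bump c : {within K, continuous bump e s c}.
Proof.
apply/subspace_continuousP => x Kx.
have Fw : Filter (within K (nbhs x)) by exact: within_filter.
have h c' : hat e c' y @[y --> within K (nbhs x)] --> hat e c' x.
  by apply: cvg_within_filter; exact: continuous_hat.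
apply: cvgM; first exact: h.
apply: cvgV; first by rewrite gt_eqF // hat_sum_gt0.
by apply: (@cvg_sumr _ _ _ (within K (nbhs x))).
Qed.

(** As the bumps add up to 1, the error is the average of [f x - f c] with weights that vanish
    unless [|x - c| < e]. *)
Lemma bump_approx (f : M -> R) (a C : R) x : 0 <= C -> K x ->
  (forall y z, K y -> K z -> `|f z - f y| <= a + C * `|z - y|) ->
  `|f x - \sum_(c <- s) f c * bump e s c x| <= a + C * e.
Proof.
move=> C0 Kx fC.
rewrite -[X in X - _]mulr1 -(sum_bump Kx) mulr_sumr -sumrB.
apply: (le_trans (ler_norm_sum _ _ _)).
rewrite -[leRHS]mulr1 -(sum_bump Kx) mulr_sumr big_seq [leRHS]big_seq.
apply: ler_sum => c cs; rewrite -mulrBl normrM (ger0_norm (bump_ge0 c Kx)).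
have [xc|xc] := ltP `|x - c| e.
  apply: ler_wpM2r; first exact: bump_ge0.
  apply: le_trans (fC _ _ (sK cs) Kx) _; rewrite lerD2l ler_wpM2l //.
  exact: ltW.
have -> : bump e s c x = 0; last by rewrite !mulr0.
rewrite /bump (_ : hat e c x = 0) ?mul0r //.
by apply/eqP; rewrite eq_le hat_ge0 andbT leNgt hat_gt0 -leNgt.
Qed.

End Bump.

Lemma intK_sum nu (s : seq M) (a : M -> R) (h : M -> M -> R) : nu K = 1%E ->
  (forall c, {within K, continuous h c}) ->
  bounded_meas K (fun x => \sum_(c <- s) a c * h c x) /\
  intK B nu (fun x => \sum_(c <- s) a c * h c x) =
  \sum_(c <- s) a c * intK B nu (h c).
Proof.
move=> nK ch; have bh c : bounded_meas K (fun x => a c * h c x).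
  by apply: bounded_measZ => //; exact: bounded_meas_continuous.
have z : bounded_meas K (fun _ : M => 0 : R) by exact: bounded_meas_cst.
elim: s => [|c s [IH1 IH2]].
  rewrite big_nil -[RHS](intK_cst B_compact nK 0).
  have e0 : (fun x => \sum_(c <- [::]) a c * h c x) = (fun=> 0).
    by apply/funext => x; rewrite big_nil.
  by rewrite e0.
have e1 : (fun x => \sum_(i <- c :: s) a i * h i x) =
    (fun x => a c * h c x + \sum_(i <- s) a i * h i x).
  by apply/funext => x; rewrite big_cons.
rewrite e1; split; first exact: bounded_measD.
rewrite intKD // IH2 big_cons intKZ //; exact: bounded_meas_continuous.
Qed.

(* The weak star topology is not a priori first countable; sequences suffice
   because C(K) is separable: on the net of mesh 1/(n+1) finitely many bump
   functions approximate every test function, up to an error vanishing in n. *)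
Lemma closure_cvg_seq (E : set (probability M R)) gamma :
  (forall nu, E nu -> nu K = 1%E) -> gamma K = 1%E ->
  closure (E : set (weak_star B)) gamma ->
  exists g : nat -> probability M R, (forall n, E (g n)) /\
    forall f : M -> R, {within K, continuous f} ->
      \int[g n]_(x in K) f x @[n --> \oo] --> \int[gamma]_(x in K) f x.
Proof.
move=> EK gK clE.
have n0 (n : nat) : 0 < n.+1%:R^-1 :> R by rewrite invr_gt0.
have /choice[s sP] : forall n : nat, exists s : seq M, (forall c, c \in s -> K c) /\
    forall x, K x -> exists2 c, c \in s & `|x - c| < n.+1%:R^-1.
  by move=> n; have [s] := finite_net (n0 n); exists s.
pose h n := bump n.+1%:R^-1 (s n).
have ch n c : {within K, continuous h n c}.
  by apply: within_continuous_bump; exact: (sP n).2.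
(* The tolerance is divided by [size (s n) + 1]: the errors on all bumps add up to at most
   [1/(n+1)], and the tolerance is positive even for an empty net. *)
have /choice[g gP] : forall n, exists nu, E nu /\ forall c, c \in s n ->
    `|intK B nu (h n c) - intK B gamma (h n c)| < n.+1%:R^-1 / (size (s n)).+1%:R.
  move=> n; have t0 : 0 < n.+1%:R^-1 / (size (s n)).+1%:R :> R by rewrite divr_gt0.
  have nb : forall l : seq M, nbhs (gamma : weak_star B) [set nu | forall c, c \in l ->
      `|intK B nu (h n c) - intK B gamma (h n c)| < n.+1%:R^-1 / (size (s n)).+1%:R].
    elim=> [|c l IH].
      apply: (@filterS _ (nbhs (gamma : weak_star B)) _ setT) (filterT) => nu _ c.
      by rewrite in_nil.
    apply: (filterS _ (filterI (weak_star_nbhs gamma (ch n c) t0) IH)).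
    move=> nu [h1 h2] c'; rewrite in_cons => /orP[/eqP->|]; first exact: h1.
    exact: h2.
  by have [nu [Enu nuP]] := clE _ (nb (s n)); exists nu.
exists g; split=> [n|f cf]; first by case: (gP n).
apply/cvgrPdist_le => e e0.
(* The final error is at most [2 (e/8 + C t) + |A| t] with [(2 C + |A|) t < e/8], hence less than
   [e]. *)
have e8 : 0 < e / 8 by lra.
have [C C0 HC] : exists2 C, 0 <= C & forall y z, K y -> K z ->
    `|f z - f y| <= e / 8 + C * `|z - y|.
  pose D (yz : M * M) := `|yz.2 - yz.1|.
  have cD : continuous D.
    by move=> yz; apply: cvg_norm; apply: cvgB; [exact: cvg_snd|exact: cvg_fst].
  apply: (compact_modulus (compact_set_pow B_compact) cf (continuous_subspaceT cD)) => //.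
    by move=> y z _ _; exact: normr_ge0.
  by move=> y z _ _ yz; rewrite normr_gt0 subr_eq0 eq_sym.
have [A HA] := within_continuous_bounded (compact_set_pow B_compact) cf.
have inv0 : (n.+1%:R^-1 : R) @[n --> \oo] --> 0 by exact: cvg_harmonic.
have lim0 : ((2 * C + `|A|) * n.+1%:R^-1) @[n --> \oo] --> 0.
  by rewrite -(mulr0 (2 * C + `|A|)); exact: (cvgM (cvg_cst _) inv0).
near=> n.
have nlt : (2 * C + `|A|) * n.+1%:R^-1 < e / 8.
  by near: n; exact: (cvgr_lt _ lim0 _ e8).
set t := n.+1%:R^-1 in nlt.
pose fn x := \sum_(c <- s n) f c * h n c x.
have approx nu : nu K = 1%E -> `|intK B nu f - intK B nu fn| <= e / 8 + C * t.
  move=> nK; have [bfn _] := intK_sum (s n) f nK (ch n).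
  have bf := bounded_meas_continuous B_compact cf.
  rewrite -intKB // -(intK_cst B_compact nK (e / 8 + C * t)).
  apply: (le_trans (ler_norm_intK B_compact nu (bounded_measB bf bfn))).
  apply: le_intK => //.
  - by apply: bounded_meas_norm => //; exact: bounded_measB.
  - exact: bounded_meas_cst.
  - by move=> x Kx; apply: bump_approx => //; [exact: (sP n).1|exact: (sP n).2].
have [Eg gn] := gP n.
have fn_close : `|intK B (g n) fn - intK B gamma fn| <= `|A| * t.
  have [_ ->] := intK_sum (s n) f (EK _ Eg) (ch n).
  have [_ ->] := intK_sum (s n) f gK (ch n).
  rewrite -sumrB; apply: (le_trans (ler_norm_sum _ _ _)).
  apply: (@le_trans _ _ (\sum_(c <- s n) `|A| * (t / (size (s n)).+1%:R))).
    rewrite big_seq [leRHS]big_seq; apply: ler_sum => c cs.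
    rewrite -mulrBr normrM; apply: ler_pM => //; last exact/ltW/gn.
    by apply: le_trans (ler_norm A); apply: HA; exact: (sP n).1.
  rewrite big_const_seq count_predT iter_addr addr0 -[leLHS]mulr_natr -mulrA.
  have t0 : 0 <= t by apply: ltW; exact: n0.
  have sz : (size (s n))%:R <= (size (s n)).+1%:R :> R by rewrite ler_nat.
  apply: ler_wpM2l => //.
  by rewrite mulrAC ler_pdivrMr ?ltr0n //; exact: ler_wpM2l.
have := approx _ (EK _ Eg); have := approx _ gK.
rewrite -[\int[gamma]_(_ in _) _]/(intK B gamma f).
rewrite -[\int[g n]_(_ in _) _]/(intK B (g n) f).
move: fn_close nlt; rewrite !ler_norml => /andP[? ?] ? /andP[? ?] /andP[? ?].
by apply/andP; split; lra.
Unshelve. all: by end_near. Qed.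

End WeakStar.

(** * Efficiency, comonotonicity and weak-star closure *)

Theorem theorem4p6 (R : realType) (dsp : measure_display)
    (T : measurableType dsp) (P : probability T R) (hP : nonatomic P)
    (d p : nat) (hd : (0 < d)%N) (hp : (0 < p)%N)
    (X : {RV P >-> 'rV[R]_d}) (hX : (@enorm R d \o X) \in Lfun P +oo%E)
    (r : R) (hr : 0 < r)
    (hB : distribution P X (dilate p%:R (@eclosed_ball R d r)) = 1%E)
    (gamma : probability 'M[R]_(p, d) R)
    (hgamma : allocation_in (eclosed_ball r) (distribution P X) gamma)
    (w : 'I_p -> 'rV[R]_d -> R)
    (hw : forall i, strictly_convex (eclosed_ball r) (w i) /\
                    C1_on (eclosed_ball r) (w i)) :
  let B := @eclosed_ball R d r in
  let m0 := distribution P X in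
  [/\ strictly_comonotone B m0 w gamma -> efficient B m0 gamma,
      efficient B m0 gamma ->
        forall w' : 'I_p -> 'rV[R]_d -> R,
          (forall i, strictly_convex B (w' i) /\ C1_on B (w' i)) ->
          comonotone B m0 w' gamma
    & weak_star_closure B m0 [set pi | efficient B m0 pi] =
        [set pi | comonotone B m0 w pi] /\
      forall w' : 'I_p -> 'rV[R]_d -> R,
        (forall i, strictly_convex B (w' i) /\ C1_on B (w' i)) ->
        [set pi | comonotone B m0 w' pi] = [set pi | comonotone B m0 w pi]].
Proof.
move=> B m0.
have cB : compact B by exact: compact_eclosed_ball.
have vB : convex_subset B by exact: convex_eclosed_ball.
pose ok (v : 'I_p -> 'rV[R]_d -> R) :=
  forall i, strictly_convex B (v i) /\ C1_on B (v i).
have ok_sc v : ok v -> forall i, strictly_convex B (v i).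
  by move=> hv i; case: (hv i).
have ok_cont v : ok v -> forall i, {within B, continuous v i}.
  by move=> hv i; case: (hv i) => _ [].
have part1 v nu : ok v -> strictly_comonotone B m0 v nu -> efficient B m0 nu.
  by move=> /ok_sc sv; exact: strictly_comonotone_efficient.
have part2 v nu : ok v -> efficient B m0 nu -> comonotone B m0 v nu.
  move=> okv enu; split; first by case: enu.
  have [g [sg gnu]] :=
    efficient_approx cB vB hp (ok_cont _ okv) (ok_sc _ okv) enu.
  by exists g; split=> //; exact: weak_star_cvg.
have in_closure (v : 'I_p -> 'rV[R]_d -> R) nu : comonotone B m0 v nu ->
    closure ([set pi | strictly_comonotone B m0 v pi] : set (weak_star B)) nu.
  move=> [_ [g [sg gnu]]] A /gnu[N _ AN].
  by exists (g N); split; [exact: sg|apply: AN => /=].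
have closureE v : ok v -> weak_star_closure B m0 [set pi | efficient B m0 pi] =
    [set pi | comonotone B m0 v pi].
  move=> okv; apply/seteqP; split => [nu [anu clnu]|nu cnu].
    split=> //.
    (* Efficient allocations already lie in the closure of the strictly comonotone ones, which is
       closed; so their own closure adds nothing to it. *)
    have clnu' : closure
        ([set pi | strictly_comonotone B m0 v pi] : set (weak_star B)) nu.
      move: clnu; rewrite closureE => /(_ _ (conj (@closed_closure _ _) _)).
      by apply => pi /(part2 _ _ okv); exact: in_closure.
    have EK pi : strictly_comonotone B m0 v pi -> pi (set_pow B) = 1%E.
      by case=> -[].
    have [g [sg gnu]] := closure_cvg_seq cB EK anu.2 clnu'.
    by exists g; split=> //; exact: weak_star_cvg.
  split; first by case: cnu.
  by apply: closure_subset (in_closure _ _ cnu) => pi; exact: part1.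
split; first exact: part1.
  by move=> eg w' okw'; exact: part2.
(* Both sets equal the closure of the efficient allocations, which does not involve [w]. *)
by split=> [|w' okw']; [exact: closureE|rewrite -!closureE].
Qed.
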